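(* Let $A$ be an $s\times n$ matrix, $2\le s\le n$, with entries in a totally ordered commutative group $M$. Consider Jacobi's algorithm for computing the minimal canon of $A$, in the form described in the context, i.e. with the increase of the third class rows performed by the substeps e′) and e″). Then the complexity of this algorithm is bounded by $O(s^2n)$ elementary operations.
   Context: A maximal element (maximum) of a matrix is an entry that is maximal in its column. Transversal maxima are maxima placed in pairwise different rows and columns. For $\ell\in M^s$, $A+\ell$ is the matrix $(a_{i,j}+\ell_i)$. A canon of $A$ is a vector $\ell$ with all $\ell_i\ge 0$ such that $A+\ell$ possesses $s$ transversal maxima. The minimal canon is the unique least canon for the order $\ell\le\ell'$ iff $\ell_i\le\ell'_i$ for all $i$. $F=O(G)$ means $F\le aG+b$ for some constants $a,b$. Matrices are stored in an array, so that reading or changing an entry has constant cost. The algorithm. Input: $A$. Output: the minimal canon of $A$. Throughout, $\ell$ collects the increases made to the rows, and $a_{i,j}$ denotes the entries of the current matrix $A+\ell$. Step 1 (preparation). Increase each row $i_0$ by the least element of $M$ such that one of its entries becomes maximal, namely $\min_{j=1}^n\left(\max_{i=1}^s a_{i,j}-a_{i_0,j}\right)$. The matrix obtained has at least 2 transversal maxima; find 2 of them. If $s=2$, stop; otherwise enter step 2 with these $r=2$ transversal maxima. Step 2. a) Up to reordering rows and columns, let the current transversal maxima be $a_{i,i}$, $1\le i\le r<s$; these are the starred elements. Columns $j\le r$ are left, columns $j>r$ are right; rows $i\le r$ are upper, rows $i>r$ are lower. b) If there is a maximal element in a right column and a lower row, add it to the set of transversal maxima. If this set now has $s$ elements, stop;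 otherwise repeat step 2. c) There is a path from row $i$ to row $i'$ if the starred maximum of row $i$ equals the entry of row $i'$ in the same column, or, recursively, if there are a path from $i$ to some row $i''$ and a path from $i''$ to $i'$. The first class consists of the upper rows having a right maximal element and, recursively, of the rows to which there is a path from a first class row. Construct the first class together with such paths. d) If there is no lower row of the first class, go to e′). Otherwise, take a path formed of rows $i_0,\dots,i_p$, with $i_0$ an upper row containing a right maximal element $a_{i_0,\beta}$, $i_p$ a lower row, and $a_{i_{\alpha+1},i_\alpha}=a_{i_\alpha,i_\alpha}$ for $0\le\alpha<p$. Replace the starred elements $a_{i_\alpha,i_\alpha}$ by $a_{i_{\alpha+1},i_\alpha}$, $0\le\alpha<p$, and add $a_{i_0,\beta}$, which gives $r+1$ transversal maxima. If $r+1=s$, stop; otherwise repeat step 2. e′) The third class consists of the lower rows and of all rows from which there is a path to a lower row; the second class consists of the rows in neither the first nor the third class. Let $C_{\mathrm I},C_{\mathrm{II}},C_{\mathrm{III}}$ be the three classes and $C_{\mathrm{I,II}}=C_{\mathrm I}\cup C_{\mathrm{II}}$. For each $i\in C_{\mathrm{I,II}}$, compute the minimal distance $d_i=\min_{k\in C_{\mathrm{III}}}(a_{i,i}-a_{k,i})$ between its starred maximum and the third class entries of the same column. Compute also $d_0=\min_{i\in C_{\mathrm{III}}}\min_{j=r+1}^n (m_j-a_{i,j})$, where $m_j=\max_{i\in C_{\mathrm I}}a_{i,j}$, $r<j\le n$, is the maximum of column $j$. e″) Increase every third class row by $d=\min(d_0,\min_{i\in C_{\mathrm{I,II}}}d_i)$.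 If $d=d_0$, go to b). If $d=d_{i_0}$ with $i_0\in C_{\mathrm I}$, a lower first class row has been created: go to d). If $d=d_{i_0}$ with $i_0\in C_{\mathrm{II}}$, remove $i_0$ from $C_{\mathrm{II}}$ and $C_{\mathrm{I,II}}$ and add it to the third class; replace each $d_i$, $i\in C_{\mathrm{I,II}}$, by the minimum of $d_i-d$ and $a_{i,i}-a_{i_0,i}$, replace $d_0$ by the minimum of $d_0-d$ and $\min_{j=r+1}^n(m_j-a_{i_0,j})$, and iterate e″) with these new values. When the algorithm stops, $\ell$ is returned. *)

(* Defs.v *)
From mathcomp Require Import all_boot all_order all_algebra.

Set Implicit Arguments.
Unset Strict Implicit.
Unset Printing Implicit Defensive.

Import Order.TTheory GRing.Theory Num.Theory.
Local Open Scope ring_scope.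

Definition totally_ordered_group (M : porderZmodType) : Prop :=
  total (<=%R : rel M) /\ (forall x y z : M, x <= y -> z + x <= z + y).

(* ------------------------------------------------------------------------ *)
(* A random access machine over an ordered group M: a WHILE language whose   *)
(* memory consists of registers and arrays holding naturals (indices, flags, *)
(* labels) or elements of M.  The operations on naturals are constants,      *)
(* successor and comparison; those on M are zero, addition, subtraction and  *)
(* comparison.                                                               *)
(* ------------------------------------------------------------------------ *)

Inductive nreg : Type :=
  | rs | rn                      (* dimensions of the input *)
  | ri | rj | rk                 (* loop counters and current rows *)
  | rr                           (* number of transversal maxima *)
  | rpc                          (* label of the substep to perform next *)
  | rfl                          (* is the running minimum initialized? *)
  | rp | ru | rv                 (* found rows and columns *)
  | rhd | rtl.                   (* head and tail of the queue *)

(* gd and gd0 hold d and d_0. *)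
Inductive greg : Type := gx | gy | gd | gd0.

Inductive narr : Type :=
  | star      (* column of the starred element of a row, n for lower rows *)
  | owner     (* row of the starred element of a column, s for right columns *)
  | rclass    (* the number 1, 2 or 3 of the class of a row *)
  | rmax      (* a right column in which the row has a maximal element *)
  | prev      (* predecessor on a path from a row having a right maximal
                 element; s if there is none, i.e. at such a row *)
  | queue.    (* rows met by a graph traversal *)

Inductive garr : Type :=
  | ell       (* the increases of the rows *)
  | colmax    (* the maxima of the columns *)
  | mm        (* m_j *)
  | dist.     (* d_i *)

Scheme Equality for nreg.
Scheme Equality for greg.
Scheme Equality for narr.
Scheme Equality for garr.

Inductive nexp : Type :=
  | NCst of nat
  | NReg of nreg
  | NArr of narr & nexp
  | NSuc of nexp.

(* Mat i j is the entry (i, j) of the input matrix. *)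
Inductive gexp : Type :=
  | GZero
  | GReg of greg
  | GArr of garr & nexp
  | Mat of nexp & nexp
  | GAdd of gexp & gexp
  | GSub of gexp & gexp.

Inductive bexp : Type :=
  | NEq of nexp & nexp
  | NLt of nexp & nexp
  | GEq of gexp & gexp
  | GLt of gexp & gexp
  | BNot of bexp
  | BAnd of bexp & bexp.

Inductive cmd : Type :=
  | Skip
  | NSet of nreg & nexp
  | GSet of greg & gexp
  | NStore of narr & nexp & nexp
  | GStore of garr & nexp & gexp
  | Seq of cmd & cmd
  | Cond of bexp & cmd & cmd
  | While of bexp & cmd.

Coercion NCst : nat >-> nexp.
Coercion NReg : nreg >-> nexp.
Coercion NArr : narr >-> Funclass.
Coercion GReg : greg >-> gexp.
Coercion GArr : garr >-> Funclass.

Module ProgNotations.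
Declare Scope prog_scope.
Delimit Scope prog_scope with prog.
Bind Scope prog_scope with nexp gexp bexp cmd.

Notation "x '+g' y" := (GAdd x y) (at level 50, left associativity) : prog_scope.
Notation "x '-g' y" := (GSub x y) (at level 50, left associativity) : prog_scope.
Notation "x '=n' y" := (NEq x y) (at level 70) : prog_scope.
Notation "x '<n' y" := (NLt x y) (at level 70) : prog_scope.
Notation "x '=g' y" := (GEq x y) (at level 70) : prog_scope.
Notation "x '<g' y" := (GLt x y) (at level 70) : prog_scope.
Notation "x '<>n' y" := (BNot (NEq x y)) (at level 70) : prog_scope.
Notation "b '&b' c" := (BAnd b c) (at level 75, right associativity) : prog_scope.

Notation "x '<-n' e" := (NSet x e) (at level 80) : prog_scope.
Notation "x '<-g' e" := (GSet x e) (at level 80) : prog_scope.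
Notation "a '@' i '<-n' e" := (NStore a i e) (at level 80, i at level 9) : prog_scope.
Notation "a '@' i '<-g' e" := (GStore a i e) (at level 80, i at level 9) : prog_scope.
Notation "c1 ;; c2" := (Seq c1 c2) (at level 90, right associativity) : prog_scope.
Notation "'IF' b 'THEN' c1 'ELSE' c2 'FI'" := (Cond b c1 c2)
  (at level 0, b at level 79, c1 at level 99, c2 at level 99) : prog_scope.
Notation "'IF' b 'THEN' c 'FI'" := (Cond b c Skip)
  (at level 0, b at level 79, c at level 99) : prog_scope.
Notation "'WHILE' b 'DO' c 'OD'" := (While b c)
  (at level 0, b at level 79, c at level 99) : prog_scope.
Notation "'FOR' x '<n' e 'DO' c 'OD'" :=
  (Seq (NSet x (NCst 0)) (While (NLt (NReg x) e) (Seq c (NSet x (NSuc (NReg x))))))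
  (at level 0, x at level 9, e at level 50, c at level 99) : prog_scope.

End ProgNotations.

Section Semantics.
Variable M : porderZmodType.

Record state : Type := State {
  nval : nreg -> nat;
  gval : greg -> M;
  nmem : narr -> nat -> nat;
  gmem : garr -> nat -> M;
  input : nat -> nat -> M }.

Definition set_nval (st : state) (x : nreg) (v : nat) : state :=
  State (fun y => if nreg_beq x y then v else nval st y)
        (gval st) (nmem st) (gmem st) (input st).

Definition set_gval (st : state) (x : greg) (v : M) : state :=
  State (nval st) (fun y => if greg_beq x y then v else gval st y)
        (nmem st) (gmem st) (input st).

Definition set_nmem (st : state) (a : narr) (i v : nat) : state :=
  State (nval st) (gval st)
        (fun b k => if narr_beq a b && (i == k) then v else nmem st b k)
        (gmem st) (input st).

Definition set_gmem (st : state) (a : garr) (i : nat) (v : M) : state :=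
  State (nval st) (gval st) (nmem st)
        (fun b k => if garr_beq a b && (i == k) then v else gmem st b k)
        (input st).

Fixpoint neval (st : state) (e : nexp) : nat :=
  match e with
  | NCst c => c
  | NReg x => nval st x
  | NArr a e1 => nmem st a (neval st e1)
  | NSuc e1 => (neval st e1).+1
  end.

Fixpoint geval (st : state) (e : gexp) : M :=
  match e with
  | GZero => 0
  | GReg x => gval st x
  | GArr a e1 => gmem st a (neval st e1)
  | Mat e1 e2 => input st (neval st e1) (neval st e2)
  | GAdd e1 e2 => geval st e1 + geval st e2
  | GSub e1 e2 => geval st e1 - geval st e2
  end.

Fixpoint beval (st : state) (b : bexp) : bool :=
  match b with
  | NEq e1 e2 => neval st e1 == neval st e2
  | NLt e1 e2 => (neval st e1 < neval st e2)%N
  | GEq e1 e2 => geval st e1 == geval st e2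
  | GLt e1 e2 => geval st e1 < geval st e2
  | BNot b1 => ~~ beval st b1
  | BAnd b1 b2 => beval st b1 && beval st b2
  end.

(* Every node of an expression is one elementary operation. *)
Fixpoint ncost (e : nexp) : nat :=
  match e with
  | NCst _ | NReg _ => 1
  | NArr _ e1 | NSuc e1 => (ncost e1).+1
  end.

Fixpoint gcost (e : gexp) : nat :=
  match e with
  | GZero | GReg _ => 1
  | GArr _ e1 => (ncost e1).+1
  | Mat e1 e2 => (ncost e1 + ncost e2).+1
  | GAdd e1 e2 | GSub e1 e2 => (gcost e1 + gcost e2).+1
  end.

Fixpoint bcost (b : bexp) : nat :=
  match b with
  | NEq e1 e2 | NLt e1 e2 => (ncost e1 + ncost e2).+1
  | GEq e1 e2 | GLt e1 e2 => (gcost e1 + gcost e2).+1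
  | BNot b1 => (bcost b1).+1
  | BAnd b1 b2 => (bcost b1 + bcost b2).+1
  end.

(* exec c st t st': started in state st, c terminates in state st' after t
   elementary operations. *)
Inductive exec : cmd -> state -> nat -> state -> Prop :=
  | exec_Skip st : exec Skip st 0 st
  | exec_NSet st x e :
      exec (NSet x e) st (ncost e).+1 (set_nval st x (neval st e))
  | exec_GSet st x e :
      exec (GSet x e) st (gcost e).+1 (set_gval st x (geval st e))
  | exec_NStore st a i e :
      exec (NStore a i e) st (ncost i + ncost e).+1
           (set_nmem st a (neval st i) (neval st e))
  | exec_GStore st a i e :
      exec (GStore a i e) st (ncost i + gcost e).+1
           (set_gmem st a (neval st i) (geval st e))
  | exec_Seq st st1 st2 t1 t2 c1 c2 :
      exec c1 st t1 st1 -> exec c2 st1 t2 st2 ->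
      exec (Seq c1 c2) st (t1 + t2)%N st2
  | exec_Cond st st1 t b c1 c2 :
      exec (if beval st b then c1 else c2) st t st1 ->
      exec (Cond b c1 c2) st (bcost b + t)%N st1
  | exec_While_end st b c :
      ~~ beval st b -> exec (While b c) st (bcost b) st
  | exec_While_loop st st1 st2 t1 t2 b c :
      beval st b -> exec c st t1 st1 -> exec (While b c) st1 t2 st2 ->
      exec (While b c) st (bcost b + t1 + t2)%N st2.

(* The memory holds the input A; the rest of it is arbitrary. *)
Definition loaded (s n : nat) (A : 'M[M]_(s, n)) (st : state) : Prop :=
  [/\ nval st rs = s, nval st rn = n & forall (i : 'I_s) (j : 'I_n), input st i j = A i j].

Lemma exec_det c st t1 st1 t2 st2 :
  exec c st t1 st1 -> exec c st t2 st2 -> t1 = t2 /\ st1 = st2.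
Proof.
move=> H; elim: H t2 st2 => {c st t1 st1};
  try by [move=> st x e t2 st2 H; inversion H
         |move=> st a i e t2 st2 H; inversion H].
- by move=> st t2 st2 H; inversion H.
- move=> st sa sb ta tb c1 c2 _ IH1 _ IH2 t2 st2 H.
  inversion H as [| | | | |? s1 ? u1 u2 ? ? E1 E2| | |]; subst.
  have [? ?] := IH1 _ _ E1; subst.
  by have [-> ->] := IH2 _ _ E2.
- move=> st sa t b c1 c2 _ IH t2 st2 H.
  inversion H as [| | | | | |? ? ? ? ? ? E| |]; subst.
  by have [-> ->] := IH _ _ E.
- move=> st b c nb t2 st2 H.
  inversion H as [| | | | | | | |? ? ? ? ? ? ? bT]; subst => //.
  by rewrite bT in nb.
- move=> st sa sb ta tb b c bT _ IH1 _ IH2 t2 st2 H.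
  inversion H as [| | | | | | |? ? ? nb|? s1 ? u1 u2 ? ? _ E1 E2]; subst.
    by rewrite bT in nb.
  have [? ?] := IH1 _ _ E1; subst.
  by have [-> ->] := IH2 _ _ E2.
Qed.

End Semantics.

(* ------------------------------------------------------------------------ *)
(* Jacobi's algorithm.  Rows and columns are numbered from 0 and never       *)
(* physically reordered: the arrays star and owner record the current        *)
(* transversal maxima, so that the diagonal entry a_{i,i} of an upper row i  *)
(* is the entry (i, star i), and the right columns are those with owner s.   *)
(* The increases are recorded in ell only, which holds the result when the   *)
(* machine halts.                                                            *)
(* ------------------------------------------------------------------------ *)

Definition halt := 0%N.
Definition step_b := 1%N.
Definition step_c := 2%N.
Definition step_d := 3%N.
Definition step_e1 := 4%N.
Definition step_e2 := 5%N.

Section Algorithm.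
Import ProgNotations.
Local Open Scope nat_scope.
Local Open Scope prog_scope.

(* the entry (i, j) of the current matrix A + ell *)
Definition ent (i j : nexp) : gexp := Mat i j +g ell i.
Definition starred (i : nexp) : gexp := ent i (star i).

Definition lower_row (i : nexp) : bexp := star i =n rn.
Definition upper_row (i : nexp) : bexp := star i <n rn.
Definition right_col (j : nexp) : bexp := owner j =n rs.

Definition put_star (i j : nexp) : cmd := star@i <-n j ;; owner@j <-n i.

(* x := min x e, or x := e if rfl = 0 *)
Definition min_with (x : greg) (e : gexp) : cmd :=
  IF rfl =n 0 THEN x <-g e ;; rfl <-n 1
  ELSE IF e <g x THEN x <-g e FI FI.

Definition compute_colmax : cmd :=
  FOR rj <n rn DO
    colmax@rj <-g ent 0 rj ;;
    FOR ri <n rs DO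
      IF colmax rj <g ent ri rj THEN colmax@rj <-g ent ri rj FI
    OD
  OD.

(* one transversal maximum more *)
Definition next_stage : cmd :=
  rr <-n NSuc rr ;;
  IF rr =n rs THEN rpc <-n halt ELSE rpc <-n step_b FI.

(* The two maxima: let (p, 0) be a maximum.  If there is a maximum (u, v) with
   u <> p and v <> 0, take both.  Otherwise the rows other than p have their
   maxima in column 0 and the maximum of column 1 lies in row p. *)
Definition prog_step1 : cmd :=
  FOR ri <n rs DO ell@ri <-g GZero ;; star@ri <-n rn OD ;;
  FOR rj <n rn DO owner@rj <-n rs OD ;;
  compute_colmax ;;
  FOR ri <n rs DO
    rfl <-n 0 ;;
    FOR rj <n rn DO min_with gx (colmax rj -g ent ri rj) OD ;;
    ell@ri <-g ell ri +g gx
  OD ;;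
  FOR ri <n rs DO IF ent ri 0 =g colmax 0 THEN rp <-n ri FI OD ;;
  ru <-n rs ;;
  FOR ri <n rs DO
    IF ri <>n rp THEN
      FOR rj <n rn DO
        IF rj <>n 0 &b ent ri rj =g colmax rj THEN ru <-n ri ;; rv <-n rj FI
      OD
    FI
  OD ;;
  IF ru <n rs THEN put_star rp 0 ;; put_star ru rv
  ELSE
    put_star rp 1 ;;
    IF rp =n 0 THEN put_star 1 0 ELSE put_star 0 0 FI
  FI ;;
  rr <-n 2 ;;
  IF rr =n rs THEN rpc <-n halt ELSE rpc <-n step_b FI.

Definition prog_b : cmd :=
  compute_colmax ;;
  ru <-n rs ;;
  FOR ri <n rs DO
    IF lower_row ri THEN
      FOR rj <n rn DO
        IF right_col rj &b ent ri rj =g colmax rj THEN ru <-n ri ;; rv <-n rj FI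
      OD
    FI
  OD ;;
  IF ru <n rs THEN put_star ru rv ;; next_stage ELSE rpc <-n step_c FI.

(* closes the first class under paths, starting from the rows in the queue *)
Definition close_first_class : cmd :=
  WHILE rhd <n rtl DO
    ri <-n queue rhd ;;
    rhd <-n NSuc rhd ;;
    IF upper_row ri THEN
      FOR rk <n rs DO
        IF rclass rk <>n 1 &b ent rk (star ri) =g starred ri THEN
          rclass@rk <-n 1 ;; prev@rk <-n ri ;;
          queue@rtl <-n rk ;; rtl <-n NSuc rtl
        FI
      OD
    FI
  OD.

(* All rows are first put in class 2; e' moves rows to class 3. *)
Definition prog_c : cmd :=
  rhd <-n 0 ;; rtl <-n 0 ;;
  FOR ri <n rs DO
    rclass@ri <-n 2 ;;
    IF upper_row ri THEN
      FOR rj <n rn DO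
        IF right_col rj &b ent ri rj =g colmax rj THEN
          rclass@ri <-n 1 ;; rmax@ri <-n rj
        FI
      OD ;;
      IF rclass ri =n 1 THEN
        prev@ri <-n rs ;; queue@rtl <-n ri ;; rtl <-n NSuc rtl
      FI
    FI
  OD ;;
  close_first_class ;;
  rpc <-n step_d.

(* The path is followed backwards from a lower row ru of the first class. *)
Definition prog_d : cmd :=
  ru <-n rs ;;
  FOR ri <n rs DO
    IF lower_row ri &b rclass ri =n 1 THEN ru <-n ri FI
  OD ;;
  IF ru =n rs THEN rpc <-n step_e1
  ELSE
    WHILE prev ru <n rs DO
      put_star ru (star (prev ru)) ;;
      ru <-n prev ru
    OD ;;
    put_star ru (rmax ru) ;;
    next_stage
  FI.

Definition compute_third_class : cmd :=
  rhd <-n 0 ;; rtl <-n 0 ;;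
  FOR ri <n rs DO
    IF lower_row ri THEN
      rclass@ri <-n 3 ;; queue@rtl <-n ri ;; rtl <-n NSuc rtl
    FI
  OD ;;
  WHILE rhd <n rtl DO
    rk <-n queue rhd ;;
    rhd <-n NSuc rhd ;;
    FOR ri <n rs DO
      IF rclass ri <>n 3 THEN
        IF ent rk (star ri) =g starred ri THEN
          rclass@ri <-n 3 ;; queue@rtl <-n ri ;; rtl <-n NSuc rtl
        FI
      FI
    OD
  OD.

Definition prog_e1 : cmd :=
  compute_third_class ;;
  FOR ri <n rs DO
    IF rclass ri <>n 3 THEN
      rfl <-n 0 ;;
      FOR rk <n rs DO
        IF rclass rk =n 3 THEN
          min_with gx (starred ri -g ent rk (star ri))
        FI
      OD ;;
      dist@ri <-g gx
    FI
  OD ;;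
  FOR rj <n rn DO
    IF right_col rj THEN
      rfl <-n 0 ;;
      FOR ri <n rs DO
        IF rclass ri =n 1 THEN
          IF rfl =n 0 THEN mm@rj <-g ent ri rj ;; rfl <-n 1
          ELSE IF mm rj <g ent ri rj THEN mm@rj <-g ent ri rj FI FI
        FI
      OD
    FI
  OD ;;
  rfl <-n 0 ;;
  FOR ri <n rs DO
    IF rclass ri =n 3 THEN
      FOR rj <n rn DO
        IF right_col rj THEN min_with gd0 (mm rj -g ent ri rj) FI
      OD
    FI
  OD ;;
  rpc <-n step_e2.

(* ru is the row i_0 with d = d_{i_0}, or s if d = d_0. *)
Definition prog_e2 : cmd :=
  gd <-g gd0 ;; ru <-n rs ;;
  FOR ri <n rs DO
    IF rclass ri <>n 3 THEN
      IF dist ri <g gd THEN gd <-g dist ri ;; ru <-n ri FI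
    FI
  OD ;;
  FOR ri <n rs DO
    IF rclass ri =n 3 THEN ell@ri <-g ell ri +g gd FI
  OD ;;
  IF ru =n rs THEN rpc <-n step_b
  ELSE IF rclass ru =n 1 THEN
    rhd <-n 0 ;; queue@0 <-n ru ;; rtl <-n 1 ;;
    close_first_class ;;
    rpc <-n step_d
  ELSE
    rclass@ru <-n 3 ;;
    FOR ri <n rs DO
      IF rclass ri <>n 3 THEN
        dist@ri <-g dist ri -g gd ;;
        gy <-g starred ri -g ent ru (star ri) ;;
        IF gy <g dist ri THEN dist@ri <-g gy FI
      FI
    OD ;;
    gd0 <-g gd0 -g gd ;;
    FOR rj <n rn DO
      IF right_col rj THEN
        gy <-g mm rj -g ent ru rj ;;
        IF gy <g gd0 THEN gd0 <-g gy FI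
      FI
    OD
  FI FI.

Definition jacobi : cmd :=
  prog_step1 ;;
  WHILE rpc <>n halt DO
    IF rpc =n step_b THEN prog_b
    ELSE IF rpc =n step_c THEN prog_c
    ELSE IF rpc =n step_d THEN prog_d
    ELSE IF rpc =n step_e1 THEN prog_e1
    ELSE prog_e2 FI FI FI FI
  OD.

End Algorithm.

(* Main.v *)
Require Import Defs.
From mathcomp Require Import all_boot all_order all_algebra.
From mathcomp Require Import zify.

(** The algorithm works in stages, each of which adds one transversal maximum.
    There are fewer than [s] of them, so it is enough to bound the cost of a
    stage by [O(sn)].

    Substeps b, c, d and e' are nests of counting loops, together with graph
    traversals that queue every row at most once and, in d, a path that is
    followed along strictly decreasing ranks; hence each of them costs [O(sn)]
    ([prog_b_runs], [prog_c_runs], [prog_d_runs], [prog_e1_runs]).  A pass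
    through e'' that is followed by another one costs only [O(s + n)], and
    moves a row into the third class, so that a stage has at most [s] of them
    ([promote_second_runs]).

    It remains to see that leaving e'' leads to a new transversal maximum
    before e' is reached again.  Say that a row drains if a path leads from it
    to a lower row.  Every third class row drains along third class rows, and
    increasing all of these by the same [d] preserves such paths.
    - If [d = d_0], a third class row [i] has got an entry equal to [m_j] in a
      right column [j].  This is the maximum of that column: when e' begins,
      no lower row has a maximal element there and the upper rows that have
      one are in the first class; and since [d <= d_0], no increase brings an
      entry above [m_j].  In the next b, either some lower row has a right
      maximal element, or [i] is an upper row; then c puts [i] in the first
      class, and with it the lower row to which it drains
      ([increase_d0_runs]).
    - If [d = d_i] for a first class row [i], there is now a path from [i] to
      a third class row.  Closing the first class reaches a lower row
      ([reach_from_first_runs]).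

    The minima [d_i] and [d_0] range over nonempty sets because there is a
    lower row and a right column as long as there are fewer than [s]
    transversal maxima ([matched]).

    The costs are amortized: the triple [runs] hands the operations that a
    program has not used over to its postcondition, and [phase] says how many
    operations suffice from each label of the main loop.  Assertions on values
    are proved by the partial correctness predicate [wp], while the cost of a
    program made of counting loops is read off its syntax ([bound]). *)

Set Implicit Arguments.
Unset Strict Implicit.
Unset Printing Implicit Defensive.

Import Order.TTheory GRing.Theory.
Import Defs ProgNotations.

(** * The locations that a program changes *)

Inductive loc := LN of nreg | LG of greg | LNA of narr | LGA of garr.

Definition eq_loc (l l' : loc) : bool :=
  match l, l' with
  | LN x, LN y => nreg_beq x y
  | LG x, LG y => greg_beq x y
  | LNA a, LNA b => narr_beq a b
  | LGA a, LGA b => garr_beq a b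
  | _, _ => false
  end.

Fixpoint writes (l : loc) (c : cmd) : bool :=
  match c with
  | Skip => false
  | NSet x _ => eq_loc (LN x) l
  | GSet x _ => eq_loc (LG x) l
  | NStore a _ _ => eq_loc (LNA a) l
  | GStore a _ _ => eq_loc (LGA a) l
  | Seq c1 c2 | Cond _ c1 c2 => writes l c1 || writes l c2
  | While _ c1 => writes l c1
  end.

Section Logic.
Variable M : porderZmodType.
Implicit Types (st : state M) (c : cmd) (b : bexp) (p : nat).

(** The frame property, decided by computation on the syntax of [c]: in the
    proofs below it carries facts across a program that does not write the
    locations that they mention. *)
Record keeps c st st' : Prop := Keeps {
  keepN : forall x, ~~ writes (LN x) c -> nval st' x = nval st x;
  keepG : forall x, ~~ writes (LG x) c -> gval st' x = gval st x;
  keepNA : forall a, ~~ writes (LNA a) c -> forall i, nmem st' a i = nmem st a i;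
  keepGA : forall a, ~~ writes (LGA a) c -> forall i, gmem st' a i = gmem st a i;
  keepI : forall i j, input st' i j = input st i j }.

Lemma exec_keeps c st t st' : exec c st t st' -> keeps c st st'.
Proof.
elim=> {c st t st'}.
- by move=> st; split.
- by move=> st x e; split=> //= y; case: nreg_beq.
- by move=> st x e; split=> //= y; case: greg_beq.
- by move=> st a i e; split=> //= b; case: narr_beq.
- by move=> st a i e; split=> //= b; case: garr_beq.
- move=> st st1 st2 t1 t2 c1 c2 _ [n1 g1 na1 ga1 i1] _ [n2 g2 na2 ga2 i2].
  split=> [x|x|a|a|i j] /=; rewrite ?negb_or; try by [rewrite i2 i1];
  case/andP=> H1 H2.
  + by rewrite n2 // n1.
  + by rewrite g2 // g1.
  + by move=> i; rewrite na2 // na1.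
  + by move=> i; rewrite ga2 // ga1.
- move=> st st1 t b c1 c2 _ [n1 g1 na1 ga1 i1].
  split=> [x|x|a|a|i j] /=; rewrite ?negb_or //; case/andP=> H1 H2;
  [apply: n1|apply: g1|apply: na1|apply: ga1]; by case: ifP.
- by move=> st b c _; split.
- move=> st st1 st2 t1 t2 b c _ _ [n1 g1 na1 ga1 i1] _ [n2 g2 na2 ga2 i2].
  split=> [x|x|a|a|i j] /=; last by rewrite i2 i1.
  + by move=> H; rewrite n2 // n1.
  + by move=> H; rewrite g2 // g1.
  + by move=> H i; rewrite na2 // na1.
  + by move=> H i; rewrite ga2 // ga1.
Qed.

Lemma keeps_trans c c' st st1 st2 :
  (forall l, writes l c' -> writes l c) ->
  keeps c st st1 -> keeps c' st1 st2 -> keeps c st st2.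
Proof.
move=> sub [n1 g1 na1 ga1 i1] [n2 g2 na2 ga2 i2].
have sub' l : ~~ writes l c -> ~~ writes l c' by apply: contra; apply: sub.
split=> [x w|x w|a w i|a w i|i j]; last by rewrite i2 i1.
- by rewrite n2 ?n1 ?sub'.
- by rewrite g2 ?g1 ?sub'.
- by rewrite na2 ?na1 ?sub'.
- by rewrite ga2 ?ga1 ?sub'.
Qed.

(** * Partial correctness *)

Definition wp c (Q : state M -> Prop) st : Prop :=
  forall t st', exec c st t st' -> Q st'.

Lemma wp_keeps c (Q : state M -> Prop) st :
  wp c (fun st' => keeps c st st' -> Q st') st -> wp c Q st.
Proof. by move=> H t st' E; apply: (H _ _ E); apply: exec_keeps E. Qed.

Lemma wp_mono c (Q Q' : state M -> Prop) st :
  wp c Q' st -> (forall st', keeps c st st' -> Q' st' -> Q st') -> wp c Q st.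
Proof. by move=> H HQ t st' E; apply: HQ (H _ _ E); apply: exec_keeps E. Qed.

Lemma wp_skip (Q : state M -> Prop) st : Q st -> wp Skip Q st.
Proof. by move=> q t st' E; inversion E; subst. Qed.

Lemma wp_nset x e (Q : state M -> Prop) st :
  Q (set_nval st x (neval st e)) -> wp (NSet x e) Q st.
Proof. by move=> q t st' E; inversion E; subst. Qed.

Lemma wp_gset x e (Q : state M -> Prop) st :
  Q (set_gval st x (geval st e)) -> wp (GSet x e) Q st.
Proof. by move=> q t st' E; inversion E; subst. Qed.

Lemma wp_nstore a i e (Q : state M -> Prop) st :
  Q (set_nmem st a (neval st i) (neval st e)) -> wp (NStore a i e) Q st.
Proof. by move=> q t st' E; inversion E; subst. Qed.

Lemma wp_gstore a i e (Q : state M -> Prop) st :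
  Q (set_gmem st a (neval st i) (geval st e)) -> wp (GStore a i e) Q st.
Proof. by move=> q t st' E; inversion E; subst. Qed.

Lemma wp_seq c1 c2 (Q : state M -> Prop) st :
  wp c1 (wp c2 Q) st -> wp (Seq c1 c2) Q st.
Proof. by move=> H t st' E; inversion E; subst; apply: H; eauto. Qed.

Lemma wp_cond b c1 c2 (Q : state M -> Prop) st :
  (beval st b -> wp c1 Q st) -> (~~ beval st b -> wp c2 Q st) ->
  wp (Cond b c1 c2) Q st.
Proof.
move=> H1 H2 t st' E.
inversion E as [| | | | | |? ? ? ? ? ? E1| |]; subst.
by case: ifP E1 => B E1; [apply: H1 E1|apply: H2 E1; rewrite B].
Qed.

Lemma wp_while (Inv : state M -> Prop) b c (Q : state M -> Prop) st :
  Inv st -> (forall st1, Inv st1 -> beval st1 b -> wp c Inv st1) ->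
  (forall st1, Inv st1 -> ~~ beval st1 b -> Q st1) -> wp (While b c) Q st.
Proof.
move=> I0 HI HQ t st' E; move Ec: (While b c) E => w E.
elim: E I0 Ec => // {st t st' w}.
  by move=> st b' c' nb I [Eb _]; apply: HQ => //; rewrite Eb.
move=> st st1 st2 t1 t2 b' c' bT E1 _ _ IH I [Eb Ec]; subst b' c'.
by apply: IH => //; apply: HI I bT _ _ E1.
Qed.

(** The invariant [Inv k] holds when the body is about to be run with counter
    [k].  The frame of the whole loop, from its initial state, is available in
    the body, so that invariants only mention what the loop changes. *)
Lemma wp_for x y c (Inv : nat -> state M -> Prop) (Q : state M -> Prop) st :
  ~~ writes (LN x) c -> ~~ nreg_beq x y -> ~~ writes (LN y) c ->
  Inv 0 (set_nval st x 0) ->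
  (forall k st1, k < nval st y -> nval st1 x = k ->
     keeps (FOR x <n y DO c OD)%prog st st1 -> Inv k st1 ->
     wp c (fun st2 => Inv k.+1 (set_nval st2 x k.+1)) st1) ->
  (forall st1, keeps (FOR x <n y DO c OD)%prog st st1 ->
     Inv (nval st y) st1 -> Q st1) ->
  wp (FOR x <n y DO c OD)%prog Q st.
Proof.
move=> wx xy wy I0 HI HQ; apply: wp_keeps; apply: wp_seq; apply: wp_nset => /=.
set st0 := set_nval st x 0.
have nxy : nreg_beq x y = false by apply/negbTE.
have xx : nreg_beq x x = true by case: (x).
have k0 : keeps (FOR x <n y DO c OD)%prog st st0.
  split=> //= z; rewrite !negb_or; case/and3P=> H _ _.
  by rewrite (negbTE H).
have y0 : nval st0 y = nval st y by rewrite /st0 /= nxy.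
pose J st1 := [/\ nval st1 x <= nval st y, nval st1 y = nval st y,
  keeps (FOR x <n y DO c OD)%prog st st1 & Inv (nval st1 x) st1].
apply: (@wp_while J).
- by split=> //=; rewrite xx.
- move=> st1 [le1 y1 k1 I1] /=; rewrite y1 => lt1.
  apply: wp_seq; apply: wp_mono (HI _ _ lt1 erefl k1 I1) _ => st2 k2 I2.
  apply: wp_nset => /=.
  have x2 : nval st2 x = nval st1 x by apply: keepN k2 _ wx.
  have y2 : nval st2 y = nval st y by rewrite -y1; apply: keepN k2 _ wy.
  split; rewrite /= ?xx ?nxy ?x2 //.
  case: k1 k2 => kn kg kna kga ki [kn2 kg2 kna2 kga2 ki2].
  split=> //= [z|z|a|a|i j].
  + rewrite !negb_or => /and3P[H1 H2 H3]; rewrite (negbTE H1) kn2 // kn //=.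
    by rewrite !negb_or H1 H2.
  + by move=> H; rewrite kg2 ?kg //; move: H; rewrite !orbF.
  + by move=> H i; rewrite kna2 ?kna //; move: H; rewrite !orbF.
  + by move=> H i; rewrite kga2 ?kga //; move: H; rewrite !orbF.
  + by rewrite ki2 ki.
- move=> st1 [le1 y1 k1 I1] /=; rewrite y1 -leqNgt => ge1 k2.
  apply: HQ => //; suff <- : nval st1 x = nval st y by [].
  by apply/eqP; rewrite eqn_leq le1.
Qed.

(** * Termination within a credit of operations *)

(** Total correctness with amortized cost: started with a credit of [p]
    operations, [c] terminates and leaves a credit [p'] to [Q].  Handing over
    what is left frees the rule for sequences from arithmetic. *)
Definition runs c p st (Q : nat -> state M -> Prop) : Prop :=
  exists t st' p', [/\ exec c st t st', t + p' <= p & Q p' st'].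

Lemma runs_keeps c p st Q :
  runs c p st (fun p' st' => keeps c st st' -> Q p' st') -> runs c p st Q.
Proof.
case=> t [st' [p' [E le q]]]; exists t, st', p'; split=> //.
by apply: q; apply: exec_keeps E.
Qed.

Lemma runs_mono c p st (Q Q' : nat -> state M -> Prop) :
  runs c p st Q' -> (forall p' st', keeps c st st' -> Q' p' st' -> Q p' st') ->
  runs c p st Q.
Proof.
case=> t [st' [p' [E le q]]] H; exists t, st', p'; split=> //.
by apply: H q; apply: exec_keeps E.
Qed.

Lemma runs_seq c1 c2 p st Q :
  runs c1 p st (fun p1 st1 => runs c2 p1 st1 Q) -> runs (Seq c1 c2) p st Q.
Proof.
case=> t1 [st1 [p1 [E1 le1 [t2 [st2 [p2 [E2 le2 q]]]]]]].
exists (t1 + t2), st2, p2; split=> //; last by lia.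
exact: exec_Seq E1 E2.
Qed.

Lemma runs_assoc c1 c2 c3 p st Q :
  runs (Seq (Seq c1 c2) c3) p st Q -> runs (Seq c1 (Seq c2 c3)) p st Q.
Proof.
case=> t [st' [p' [E le q]]]; exists t, st', p'; split=> //.
inversion E as [| | | | |? st2 ? t12 t3 ? ? E12 E3| | |]; subst.
inversion E12 as [| | | | |? st1 ? t1 t2 ? ? E1 E2| | |]; subst.
by rewrite -addnA; apply: exec_Seq E1 (exec_Seq E2 E3).
Qed.

Lemma runs_cond b c1 c2 p q st Q :
  bcost b + q <= p ->
  (beval st b -> runs c1 q st Q) -> (~~ beval st b -> runs c2 q st Q) ->
  runs (Cond b c1 c2) p st Q.
Proof.
move=> lep H1 H2.
have [t [st' [p' [E le h]]]] : runs (if beval st b then c1 else c2) q st Q.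
  by case: ifP => B; [apply: H1|apply: H2; rewrite B].
exists (bcost b + t), st', p'; split=> //; last by lia.
exact: exec_Cond.
Qed.

Lemma bcost_gt0 b : 0 < bcost b.
Proof. by case: b. Qed.

(** Evaluating the test costs at least one operation, so that the credit
    itself is a variant. *)
Lemma runs_while b c (Inv : nat -> state M -> Prop) p st :
  (forall q st1, Inv q st1 -> beval st1 b ->
     exists2 q', bcost b + q' <= q & runs c q' st1 Inv) ->
  Inv p st ->
  runs (While b c) (bcost b + p) st
       (fun p' st' => Inv p' st' /\ ~~ beval st' b).
Proof.
move=> H; elim/ltn_ind: p st => p IH st I.
case B: (beval st b); last first.
  exists (bcost b), st, p; split; rewrite ?B //.
  by apply: exec_While_end; rewrite B.
have [q le [t [st1 [p1 [E le1 I1]]]]] := H _ _ I B.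
have b0 := bcost_gt0 b.
have lt1 : p1 < p by lia.
have [t' [st2 [p2 [E2 le2 I2]]]] := IH _ lt1 _ I1.
exists (bcost b + t + t'), st2, p2; split=> //; last by lia.
exact: exec_While_loop E E2.
Qed.

End Logic.

(** * The cost of counting loops *)

Definition dimension (x : nreg) : bool := nreg_beq x rs || nreg_beq x rn.

Definition steps_by_one (x : nreg) (c : cmd) : bool :=
  if c is Seq c1 (NSet y (NSuc (NReg z))) then
    [&& nreg_beq x y, nreg_beq x z & ~~ writes (LN x) c1]
  else false.

(** The programs all of whose loops are [FOR] loops over the rows or the
    columns, with a counter that the body does not change.  They terminate
    from every state, within a cost that depends on the dimensions only. *)
Fixpoint counted (c : cmd) : bool :=
  match c with
  | NSet x _ => ~~ dimension x
  | Seq c1 c2 | Cond _ c1 c2 => counted c1 && counted c2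
  | While (NLt (NReg x) (NReg y)) c1 =>
      [&& dimension y, steps_by_one x c1 & counted c1]
  | While _ _ => false
  | _ => true
  end.

Section Counted.
Variable M : porderZmodType.
Variables s n : nat.
Implicit Types (st : state M) (c : cmd).

(** Adding the costs of the branches of a conditional, instead of taking the
    larger one, loses a constant factor only and gives a polynomial in the
    dimensions. *)
Fixpoint bound (c : cmd) : nat :=
  match c with
  | Skip => 0
  | NSet _ e => (ncost e).+1
  | GSet _ e => (gcost e).+1
  | NStore _ i e => (ncost i + ncost e).+1
  | GStore _ i e => (ncost i + gcost e).+1
  | Seq c1 c2 => bound c1 + bound c2
  | Cond b c1 c2 => bcost b + (bound c1 + bound c2)
  | While b c1 =>
      (if b is NLt _ (NReg rs) then s else n) * (bcost b + bound c1) + bcost b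
  end.

Definition dims st := nval st rs = s /\ nval st rn = n.

Lemma dimension_counted c x : dimension x -> counted c -> ~~ writes (LN x) c.
Proof.
move=> dx; elim: c => //= [y _|c1 IH1 c2 IH2|_ c1 IH1 c2 IH2|b c IH].
- by apply: contra; case: y x dx => [] [].
- by case/andP=> /IH1 ? /IH2 ?; rewrite negb_or; apply/andP.
- by case/andP=> /IH1 ? /IH2 ?; rewrite negb_or; apply/andP.
- by case: b => // [] [] // y [] // z; case/and3P=> _ _ /IH.
Qed.

Lemma dims_keeps c st st' : counted c -> keeps c st st' -> dims st -> dims st'.
Proof.
by move=> cc k [sE nE]; split; rewrite (keepN k) // dimension_counted.
Qed.

(** The counter may start anywhere: from [x], at most [N - x] rounds remain. *)
Lemma counted_halts c st :
  counted c -> dims st -> exists t st', exec c st t st' /\ t <= bound c.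
Proof.
elim: c st => /=.
- by move=> st _ _; exists 0, st; split=> //; constructor.
- by move=> x e st _ _; do 2!eexists; split; first constructor.
- by move=> x e st _ _; do 2!eexists; split; first constructor.
- by move=> a i e st _ _; do 2!eexists; split; first constructor.
- by move=> a i e st _ _; do 2!eexists; split; first constructor.
- move=> c1 IH1 c2 IH2 st /andP[cc1 cc2] d.
  have [t1 [st1 [E1 le1]]] := IH1 _ cc1 d.
  have [t2 [st2 [E2 le2]]] := IH2 _ cc2 (dims_keeps cc1 (exec_keeps E1) d).
  by exists (t1 + t2), st2; split; [apply: exec_Seq E1 E2|lia].
- move=> b c1 IH1 c2 IH2 st /andP[cc1 cc2] d; case B: (beval st b).
    have [t1 [st1 [E1 le1]]] := IH1 _ cc1 d.
    by exists (bcost b + t1), st1; split; [constructor; rewrite B|lia].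
  have [t1 [st1 [E1 le1]]] := IH2 _ cc2 d.
  by exists (bcost b + t1), st1; split; [constructor; rewrite B|lia].
- move=> b c IH st; case: b => // [] [] // x [] // y; case/and3P=> dy sx cc d.
  set N := (X in X * _ + _).
  have yN st1 : dims st1 -> nval st1 y = N.
    by case=> sE nE; rewrite /N; case: y dy {sx N}.
  move Em: (N - nval st x) => m.
  suff [t [st' [E le]]] : exists t st', exec (While (x <n y)%prog c) st t st' /\
      t <= m * (3 + bound c) + 3.
    exists t, st'; split=> //; apply: leq_trans le _.
    by rewrite leq_add2r leq_mul2r -Em leq_subr orbT.
  elim: m st d Em => [|m IHm] st d Em.
    exists 3, st; split=> //; apply: (@exec_While_end _ st (x <n y)%prog c).
    by rewrite /= (yN _ d) -leqNgt; lia.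
  have [t1 [st1 [E1 le1]]] := IH _ cc d.
  have d1 := dims_keeps cc (exec_keeps E1) d.
  have x1 : nval st1 x = (nval st x).+1.
    case: c sx {IH cc IHm le1} E1 => // c1 [] // y1 [] // [] // z.
    case/and3P=> ? ? wx.
    have [? ?] : x = y1 /\ x = z by split; apply: internal_nreg_dec_bl.
    subst y1 z => E1.
    inversion E1 as [| | | | |? st2 ? ? ? ? ? E2 E3| | |]; subst.
    inversion E3; subst => /=.
    have -> : nreg_beq x x = true by case: (x).
    by rewrite (keepN (exec_keeps E2)).
  have [t2 [st2 [E2 le2]]] := IHm st1 d1 ltac:(lia).
  exists (3 + t1 + t2), st2; split; last by lia.
  apply: (@exec_While_loop _ st st1 st2 t1 t2 (x <n y)%prog c) => //=.
  by rewrite (yN _ d); lia.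
Qed.

Lemma runs_counted c p q st (Q : nat -> state M -> Prop) :
  counted c -> bound c + q <= p -> dims st ->
  wp c (Q q) st -> runs c p st Q.
Proof.
move=> cc le d H; have [t [st' [E le']]] := counted_halts cc d.
by exists t, st', q; split; [|lia|apply: H E].
Qed.

End Counted.

Ltac wp_step :=
  lazymatch goal with
  | |- wp (Seq (NSet _ (NCst 0)) (While _ _)) _ _ => fail
  | |- wp (Seq _ _) _ _ => apply: wp_seq
  | |- wp (NSet _ _) _ _ => apply: wp_nset
  | |- wp (GSet _ _) _ _ => apply: wp_gset
  | |- wp (NStore _ _ _) _ _ => apply: wp_nstore
  | |- wp (GStore _ _ _) _ _ => apply: wp_gstore
  | |- wp Skip _ _ => apply: wp_skip
  | |- wp (put_star _ _) _ _ => rewrite /put_star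
  end.
Ltac wp_run := repeat wp_step; rewrite /=.

(** * Counting and ordered groups *)

Lemma count_change (P P' : pred nat) (u m : nat) :
  (forall i, i < m -> i != u -> P i -> P' i) ->
  count P (iota 0 m) <= (count P' (iota 0 m)).+1.
Proof.
move=> H; apply: (@leq_trans (count (predU P' (pred1 u)) (iota 0 m))).
  rewrite -!size_filter; apply: uniq_leq_size.
    by rewrite filter_uniq // iota_uniq.
  move=> i; rewrite !mem_filter mem_iota /= => /andP[Pi im].
  by rewrite im andbT; case: eqP; rewrite ?orbT // orbF => /eqP iu; apply: H.
rewrite -addn1; apply: leq_trans (leq_addr (count (predI P' (pred1 u)) (iota 0 m)) _) _; rewrite count_predUI leq_add2l.
by rewrite (count_uniq_mem _ (iota_uniq _ _)); case: (_ \in _).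
Qed.

Lemma count_drop (P P' : pred nat) (u m : nat) :
  u < m -> P u -> ~~ P' u -> (forall i, i != u -> P' i = P i) ->
  (count P' (iota 0 m)).+1 = count P (iota 0 m).
Proof.
move=> um Pu P'u H.
have E : count P' (iota 0 m) = count (predI P (predC1 u)) (iota 0 m).
  apply: eq_count => i /=; case: eqP => [->|/eqP iu]; last by rewrite andbT H.
  by rewrite andbF; apply/negbTE.
have := count_predUI (predI P (predC1 u)) (pred1 u) (iota 0 m).
have -> : count (predI (predI P (predC1 u)) (pred1 u)) (iota 0 m) = 0.
  by rewrite -[RHS](count_pred0 (iota 0 m)); apply: eq_count => i /=; case: eqP; rewrite ?andbF.
have -> : count (predU (predI P (predC1 u)) (pred1 u)) (iota 0 m) = count P (iota 0 m).
  by apply: eq_count => i /=; case: eqP => [->|] /=; rewrite ?Pu ?orbF ?andbT.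
by rewrite (count_uniq_mem _ (iota_uniq _ _)) mem_iota um addn0 E addn1 => ->.
Qed.

Lemma count_iotaS (P : pred nat) k :
  count P (iota 0 k.+1) = count P (iota 0 k) + P k.
Proof. by rewrite -addn1 iotaD count_cat /= addn0. Qed.

Section Ordered.
Variable M : porderZmodType.
Hypothesis ordM : totally_ordered_group M.
Local Open Scope ring_scope.

Lemma nltG (x y : M) : ~~ (x < y) -> y <= x.
Proof.
case: ordM => tot _; case/orP: (tot x y) => //.
by rewrite le_eqVlt => /orP[/eqP-> //|->].
Qed.

Lemma leG_add2r (x y z : M) : x <= y -> x + z <= y + z.
Proof. by case: ordM => _ mon /(mon _ _ z); rewrite !(addrC z). Qed.

Lemma leG_subRL (x y z : M) : x <= y - z -> z + x <= y.
Proof. by move/(leG_add2r z); rewrite subrK addrC. Qed.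

Lemma leG_sub2r (x y z : M) : x <= y -> x - z <= y - z.
Proof. exact: leG_add2r. Qed.

End Ordered.

Section Jacobi.
Variable M : porderZmodType.
Hypothesis ordM : totally_ordered_group M.
Variables s n : nat.
Hypothesis sn : 2 <= s <= n.
Implicit Types (st : state M) (c : cmd).

Local Notation dims := (dims s n).
Local Notation third st := (fun k => nmem st rclass k == 3).

(** The entry of the current matrix, i.e. the value of [ent i j]. *)
Definition cur st (i j : nat) : M := (input st i j + gmem st ell i)%R.

Lemma cur_keeps c st st' i j :
  ~~ writes (LGA ell) c -> keeps c st st' -> cur st' i j = cur st i j.
Proof. by move=> w k; rewrite /cur (keepI k) (keepGA k). Qed.

(** * Stars, lower rows and right columns *)

(** What a stage needs to know about the stars, when there are at least [s - r]
    lower rows and [n - r] right columns.  As the star of an upper row lies in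
    a column that is not right, switching a path frees no column and uses one
    right column only. *)
Record matched (r : nat) st : Prop := Matched {
  star_le : forall i, i < s -> nmem st star i <= n;
  star_owned : forall i, i < s -> nmem st star i < n ->
    nmem st owner (nmem st star i) != s;
  lower_left : s <= r + count (fun i => nmem st star i == n) (iota 0 s);
  right_left : n <= r + count (fun j => nmem st owner j == s) (iota 0 n) }.

Lemma matched_keeps c r st st' :
  ~~ writes (LNA star) c && ~~ writes (LNA owner) c ->
  keeps c st st' -> matched r st -> matched r st'.
Proof.
case/andP=> ws wo k; have es := keepNA k ws; have eo := keepNA k wo.
case=> sl so ll rl; split=> [i /sl|i /so||]; rewrite ?es ?eo //.
- by under eq_count do rewrite es.
- by under eq_count do rewrite eo.
Qed.

(** A stage uses up one lower row and one right column. *)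
Lemma matched_next r st st' u v :
  matched r st ->
  (forall i, i < s -> nmem st' star i <= n) ->
  (forall i, i < s -> nmem st' star i < n ->
     nmem st' owner (nmem st' star i) != s) ->
  (forall i, i < s -> i != u -> nmem st star i = n -> nmem st' star i = n) ->
  (forall j, j < n -> j != v -> nmem st owner j = s -> nmem st' owner j = s) ->
  matched r.+1 st'.
Proof.
case=> sl so ll rl sl' so' lower right; split=> //.
- have := @count_change (fun i => nmem st star i == n) (fun i => nmem st' star i == n) u s.
  suff H i : i < s -> i != u -> nmem st star i == n -> nmem st' star i == n.
    by move/(_ H); lia.
  by move=> ? ? /eqP ?; apply/eqP; apply: lower.
- have := @count_change (fun i => nmem st owner i == s) (fun i => nmem st' owner i == s) v n.
  suff H i : i < n -> i != v -> nmem st owner i == s -> nmem st' owner i == s.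
    by move/(_ H); lia.
  by move=> ? ? /eqP ?; apply/eqP; apply: right.
Qed.

(** Row [u] may lie outside the matrix: step 1 puts a star in row [rp] whether
    or not its loop has set [rp].  Such a star belongs to no row, and it must
    then be in a column without stars. *)
Lemma matched_put r st st' u v :
  matched r st -> v < n ->
  (s <= u -> forall i, i < s -> nmem st star i != v) ->
  (forall i, nmem st' star i = if u == i then v else nmem st star i) ->
  (forall j, nmem st' owner j = if v == j then u else nmem st owner j) ->
  matched r.+1 st'.
Proof.
move=> m vn fresh es eo; case: (m) => sl so _ _.
apply: (matched_next m (u := u) (v := v)) => i; rewrite ?es ?eo.
- by case: eqP => // _; [lia|apply: sl].
- move=> i_s; case: (eqVneq u i) => [ui|iu]; first by rewrite eqxx ui ltn_eqF.
  case: (v =P nmem st star i) => [vi _|_]; last exact: so.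
  case: (leqP s u) => [su|us]; last by rewrite ltn_eqF.
  by have := fresh su i i_s; rewrite vi eqxx.
- by rewrite eq_sym => _ /negbTE->.
- by rewrite eq_sym => _ /negbTE->.
Qed.

Lemma lower_exists r st : matched r st -> r < s ->
  exists2 i, i < s & nmem st star i = n.
Proof.
case=> _ _ ll _ rs; have : has (fun i => nmem st star i == n) (iota 0 s).
  by rewrite has_count; lia.
by case/hasP=> i; rewrite mem_iota => /andP[_ ?] /eqP ?; exists i.
Qed.

Lemma right_exists r st : matched r st -> r < n ->
  exists2 j, j < n & nmem st owner j = s.
Proof.
case=> _ _ _ rl rn; have : has (fun j => nmem st owner j == s) (iota 0 n).
  by rewrite has_count; lia.
by case/hasP=> j; rewrite mem_iota => /andP[_ ?] /eqP ?; exists j.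
Qed.

Definition base r st : Prop :=
  [/\ dims st, nval st rr = r, r < s & matched r st].

Lemma base_keeps c r st st' :
  [&& ~~ writes (LN rs) c, ~~ writes (LN rn) c, ~~ writes (LN rr) c,
      ~~ writes (LNA star) c & ~~ writes (LNA owner) c] ->
  keeps c st st' -> base r st -> base r st'.
Proof.
case/and5P=> w1 w2 w3 w4 w5 k [[d1 d2] e lt m].
split=> //; first by split; rewrite (keepN k).
  by rewrite (keepN k).
by apply: (matched_keeps _ k m); rewrite w4.
Qed.

(** * Paths to the lower rows *)

(** An elementary path: row [k] has the starred value of row [i] in the column
    of that star. *)
Definition edge st (i k : nat) : Prop :=
  cur st k (nmem st star i) = cur st i (nmem st star i).

(** There is a path from row [i] to a lower row through rows that satisfy
    [P].  Taking the third class for [P] gives paths that survive the increase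
    of that class. *)
Inductive drains (P : pred nat) st : nat -> Prop :=
| drains_lower i : i < s -> P i -> nmem st star i = n -> drains P st i
| drains_edge i k : i < s -> P i -> nmem st star i < n -> edge st i k ->
    drains P st k -> drains P st i.

Lemma drains_lt P st i : drains P st i -> i < s.
Proof. by case. Qed.

Lemma drains_in P st i : drains P st i -> P i.
Proof. by case. Qed.

Lemma drains_mono (P P' : pred nat) st st' i :
  (forall k, k < s -> P k -> P' k) ->
  (forall k, nmem st' star k = nmem st star k) ->
  (forall k l, k < s -> l < s -> P k -> P l -> edge st k l -> edge st' k l) ->
  drains P st i -> drains P' st' i.
Proof.
move=> PP es ee; elim=> {i} [i i_s Pi lo|i k i_s Pi up e d IH].
  by apply: drains_lower; rewrite ?es //; apply: PP.
apply: (@drains_edge _ _ i k); rewrite ?es //; first exact: PP.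
by apply: ee => //; [apply: drains_lt d|apply: drains_in d].
Qed.

(** How a path is used: the first class, being closed under edges, spreads
    along it down to its lower row. *)
Lemma drains_closed (P : pred nat) st (X : nat -> Prop) i :
  (forall k l, k < s -> l < s -> X k -> P k -> P l -> nmem st star k < n -> edge st k l -> X l) ->
  X i -> drains P st i -> exists k, [/\ k < s, nmem st star k = n & X k].
Proof.
move=> cl Xi d; elim: d Xi => {i} [i i_s _ lo Xi|i k i_s Pi up e d IH Xi].
  by exists i.
by apply: IH; apply: cl Xi Pi _ up e => //; [apply: drains_lt d|apply: drains_in d].
Qed.

(** * Right maxima and classes *)

Definition colmax_at st j : Prop :=
  (forall i, i < s -> (cur st i j <= gmem st colmax j)%R) /\
  exists2 i, i < s & cur st i j = gmem st colmax j.

Definition right_max st i j : bool :=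
  [&& j < n, nmem st owner j == s & cur st i j == gmem st colmax j].

(** The state in which e'' is left with [d = d_0]: the stage will end without
    another visit to e', see [prog_c_runs]. *)
Definition promising st : Prop := exists i j,
  [/\ i < s, j < n, nmem st owner j = s, drains predT st i &
      forall k, k < s -> (cur st k j <= cur st i j)%R].

Lemma promising_keeps c st st' :
  [&& ~~ writes (LNA star) c, ~~ writes (LNA owner) c & ~~ writes (LGA ell) c] ->
  keeps c st st' -> promising st -> promising st'.
Proof.
case/and3P=> w1 w2 w3 k [i [j [i_s jn ow dr mx]]].
have ck := cur_keeps _ _ w3 k.
exists i, j; split; rewrite ?(keepNA k) //; last first.
  by move=> l /mx; rewrite !ck.
apply: drains_mono dr => // [l|l m _ _ _ _]; first by rewrite (keepNA k).
by rewrite /edge !(keepNA k) // !ck.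
Qed.

(** The outcome of b when it finds nothing. *)
Definition scanned st : Prop :=
  (forall j, j < n -> colmax_at st j) /\
  (forall i j, i < s -> nmem st star i = n -> ~~ right_max st i j).

(** During a traversal, a row enters the class exactly when it enters the queue;
    hence [rtl + outside] never grows, and it bounds the number of rows that
    are ever queued by [s]. *)
Definition outside (cl : nat) st : nat :=
  count (fun i => nmem st rclass i != cl) (iota 0 s).

Lemma outside_le (c : nat) st : outside c st <= s.
Proof. by rewrite -[X in _ <= X](size_iota 0) count_size. Qed.

Lemma outside_lt (c : nat) st i : i < s -> nmem st rclass i = c -> outside c st < s.
Proof.
move=> i_s ci; rewrite -[X in _ < X](size_iota 0) -(count_predC (fun i => nmem st rclass i != c)).
rewrite -[X in X < _]addn0 ltn_add2l -has_count; apply/hasP; exists i.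
  by rewrite mem_iota.
by rewrite /= ci eqxx.
Qed.

(** Following [prev] from a first class row stops after at most [s] steps, at a
    row whose [rmax] is meaningful.  The rows that start the traversal have rank 0;
    a row that is added later has for rank the number of first class rows at
    that time, which is at most [s - outside 1]. *)
Definition ranked st : Prop := exists rk : nat -> nat,
  forall i, i < s -> nmem st rclass i = 1 ->
    rk i + outside 1 st <= s /\
    (if nmem st prev i < s then
       [&& nmem st rclass (nmem st prev i) == 1,
           nmem st star (nmem st prev i) < n & rk (nmem st prev i) < rk i]
     else nmem st rmax i < n).

Lemma ranked_same st st' :
  (forall i, i < s -> (nmem st' rclass i = 1 <-> nmem st rclass i = 1)) ->
  (forall i, nmem st' star i = nmem st star i) ->
  (forall i, nmem st' prev i = nmem st prev i) ->
  (forall i, nmem st' rmax i = nmem st rmax i) -> ranked st -> ranked st'.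
Proof.
move=> ec es ep em [rk H]; exists rk => i i_s c1.
have eb a : a < s -> (nmem st' rclass a == 1) = (nmem st rclass a == 1).
  by move=> as_; apply/eqP/eqP => /(ec a as_).
rewrite (_ : outside 1 st' = outside 1 st); last first.
  by apply: eq_in_count => a; rewrite mem_iota /= => as_; rewrite eb.
have [hi tl] := H i i_s ((ec i i_s).1 c1); split=> //.
by rewrite ep em es; case: ifP tl => // ps; rewrite eb.
Qed.

Lemma ranked_keeps c st st' :
  [&& ~~ writes (LNA star) c, ~~ writes (LNA rclass) c, ~~ writes (LNA prev) c &
      ~~ writes (LNA rmax) c] ->
  keeps c st st' -> ranked st -> ranked st'.
Proof.
case/and4P=> w1 w2 w3 w4 k [rk H]; exists rk => i i_s.
rewrite /outside; under eq_count do rewrite (keepNA k) //.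
by rewrite !(keepNA k) //; apply: H.
Qed.

(** The new row gets a rank above all those in use, in particular above the
    rank of its predecessor [i]. *)
Lemma ranked_add st st' i k :
  i < s -> k < s -> nmem st rclass i = 1 -> nmem st rclass k != 1 ->
  nmem st star i < n ->
  (forall l, nmem st' rclass l = if k == l then 1 else nmem st rclass l) ->
  (forall l, nmem st' prev l = if k == l then i else nmem st prev l) ->
  (forall l, nmem st' star l = nmem st star l) ->
  (forall l, nmem st' rmax l = nmem st rmax l) ->
  ranked st -> ranked st' /\ (outside 1 st').+1 = outside 1 st.
Proof.
move=> i_s ks ci ck up ec ep es em [rk H].
have O : (outside 1 st').+1 = outside 1 st.
  apply: (@count_drop _ _ k); rewrite ?ec ?eqxx // => l lk.
  by rewrite ec [k == l]eq_sym (negbTE lk).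
split=> //; exists (fun l => if k == l then s - outside 1 st' else rk l) => l ls.
have le_s : outside 1 st <= s by apply: outside_le.
have [hi _] := H i i_s ci.
have ki : (k == i) = false by apply/negbTE; apply: contraNneq ck => ->; rewrite ci.
rewrite ec ep; case: (eqVneq k l) => [<- _|kl cl].
  split; first by lia.
  by rewrite i_s ec ki ci eqxx es up; lia.
have [hl tl] := H l ls cl; split; first by lia.
case: ifP tl => [ps /and3P[cp sp rp]|_]; last by rewrite em.
have kp : (k == nmem st prev l) = false.
  by apply/negbTE; apply: contraNneq ck => ->.
by rewrite ec es kp cp sp rp.
Qed.

Definition closed_first st : Prop := forall i k, i < s -> k < s ->
  nmem st rclass i = 1 -> nmem st star i < n -> edge st i k ->
  nmem st rclass k = 1.

(** The outcome of c: the first class contains the upper rows that have a right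
    maximal element and is closed under paths; the third class is empty. *)
Definition explored st : Prop :=
  [/\ scanned st,
      forall i, i < s -> nmem st rclass i = 1 \/ nmem st rclass i = 2,
      forall i j, i < s -> right_max st i j -> nmem st rclass i = 1 &
      closed_first st].

Lemma explored_keeps c st st' :
  [&& ~~ writes (LNA star) c, ~~ writes (LNA owner) c, ~~ writes (LNA rclass) c,
      ~~ writes (LGA ell) c & ~~ writes (LGA colmax) c] ->
  keeps c st st' -> explored st -> explored st'.
Proof.
case/and5P=> w1 w2 w3 w4 w5 k [[cm nolow] cl mx cf].
have ck i j : cur st' i j = cur st i j by apply: cur_keeps k.
have mk i j : right_max st' i j = right_max st i j.
  by rewrite /right_max ck (keepNA k) // (keepGA k).
split.
- split=> [j /cm[ge [l ls el]]|i j i_s]; last by rewrite mk (keepNA k) //; apply: nolow.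
  split=> [i i_s|]; first by rewrite ck (keepGA k) //; apply: ge.
  by exists l; rewrite ?ck ?(keepGA k).
- by move=> i; rewrite (keepNA k) //; apply: cl.
- by move=> i j; rewrite mk (keepNA k) //; apply: mx.
- by move=> a b; rewrite /edge !ck !(keepNA k) //; apply: cf.
Qed.

Definition lower_first st : Prop :=
  exists i, [/\ i < s, nmem st star i = n & nmem st rclass i = 1].

(** The invariant of e''.  Each [d_i] is a difference that occurs in column
    [star i], so that an increase by [d_i] creates an edge from [i] to the third
    class; [d_0] is the minimum that it should be, so that an increase by
    [d <= d_0] keeps [m_j] above column [j]. *)
Record classified st : Prop := Classified {
  lower_third : forall i, i < s -> nmem st star i = n -> nmem st rclass i = 3;
  third_drains : forall i, i < s -> nmem st rclass i = 3 ->
    drains (fun k => nmem st rclass k == 3) st i;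
  dist_attained : forall i, i < s -> nmem st rclass i <> 3 ->
    exists k, [/\ k < s, nmem st rclass k = 3 &
      gmem st dist i = (cur st i (nmem st star i) - cur st k (nmem st star i))%R];
  gd0_attained : exists i j, [/\ i < s, nmem st rclass i = 3, j < n,
    nmem st owner j = s & gval st gd0 = (gmem st mm j - cur st i j)%R];
  gd0_le : forall i j, i < s -> nmem st rclass i = 3 -> j < n ->
    nmem st owner j = s -> (gval st gd0 <= gmem st mm j - cur st i j)%R;
  mm_ge : forall i j, i < s -> j < n -> nmem st owner j = s ->
    (cur st i j <= gmem st mm j)%R }.

(** * The credit of a state *)

(** A budget for any one substep; the constant leaves room for each of them. *)
Definition heavy := 600 * (s * n).

(** A budget for a pass through e'' that is followed by another one. *)
Definition light := 600 * (s + n).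

(** The stages that follow the one with [r] maxima; a stage takes ten heavy
    substeps. *)
Definition later r := (s - r.+1) * (10 * heavy).

Lemma later_lt r : r < s -> 10 * heavy + later r <= s * (10 * heavy).
Proof. by move=> r_s; rewrite /later -mulSn leq_mul2r; apply/orP; right; lia. Qed.

(** [phase p st]: from the head of the main loop, [p] operations suffice.
    The flag [f] of [At_b] and [At_c] tells that e'' has just been left with
    [d = d_0]: only b, c and d remain in the stage.  Likewise, [At_d] is the
    label d with a lower row in the first class, and in [At_d_or_e] this is not
    known.  In [At_e2], the rows outside the third class pay for the passes
    through e'' to come; since [s * light] is at most two heavy substeps, seven
    of these suffice in [At_e1]. *)
Inductive phase (p : nat) (st : state M) : Prop :=
| At_halt of nval st rpc = halt
| At_b r (f : bool) of nval st rpc = step_b & base r st &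
    f -> promising st & (if f then 3 else 10) * heavy + later r <= p
| At_c r (f : bool) of nval st rpc = step_c & base r st & scanned st &
    f -> promising st & (if f then 2 else 9) * heavy + later r <= p
| At_d r of nval st rpc = step_d & base r st & ranked st &
    lower_first st & heavy + later r <= p
| At_d_or_e r of nval st rpc = step_d & base r st & ranked st &
    explored st & 8 * heavy + later r <= p
| At_e1 r of nval st rpc = step_e1 & base r st & ranked st &
    explored st & ~ lower_first st & 7 * heavy + later r <= p
| At_e2 r of nval st rpc = step_e2 & base r st & ranked st &
    classified st & 4 * heavy + outside 3 st * light + later r <= p.

Lemma next_stage_wp r p st : dims st -> nval st rr = r -> r < s ->
  matched r.+1 st -> later r <= p -> wp next_stage (phase p) st.
Proof.
move=> [d1 d2] er r_s m le; rewrite /next_stage; wp_run; apply: wp_cond => /=; rewrite er d1 => e.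
  by wp_run; apply: At_halt.
wp_run; apply: (@At_b _ _ r.+1 false) => //.
  by split; [split| |rewrite ltn_neqAle e|case: m; split].
apply: leq_trans le; rewrite /later -mulSn leq_mul2r.
by apply/orP; right; have : r.+1 < s by [rewrite ltn_neqAle e|]; lia.
Qed.

(** * Substep b *)

Lemma compute_colmax_wp st : dims st ->
  wp compute_colmax (fun st' => forall j, j < n -> colmax_at st' j) st.
Proof.
move=> d.
pose top j v := (forall i, i < s -> (cur st i j <= v)%R) /\
  exists2 i, i < s & cur st i j = v.
apply: wp_keeps; apply: (wp_for (Inv := fun k st1 => forall j, j < k -> top j (gmem st1 colmax j))) => //.
- move=> k st1 kn jk k1 I1; have d1 := dims_keeps (c := compute_colmax) isT k1 d.
  have cur1 i j : (input st1 i j + gmem st1 ell i)%R = cur st i j.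
    exact: cur_keeps k1.
  wp_run; rewrite jk cur1.
  apply: (wp_for (Inv := fun m st3 =>
    [/\ forall j, j < k -> top j (gmem st3 colmax j),
        forall i, i < m -> (cur st i k <= gmem st3 colmax k)%R &
        exists2 i, i < s & cur st i k = gmem st3 colmax k])) => //=.
  + split=> // [j jk'|]; last by exists 0; [lia|rewrite eqxx].
    by case: eqP; [lia|move=> _; apply: I1].
  + rewrite (proj1 d1) => m st3 ms im k3 [I3 I3' I3''].
    have jk3 : nval st3 rj = k by rewrite (keepN k3).
    have cur3 i j : (input st3 i j + gmem st3 ell i)%R = cur st i j.
      by rewrite -cur1 (keepI k3) (keepGA k3).
    wp_run; apply: wp_cond => /=; rewrite im jk3 cur3.
      move=> lt; wp_run; rewrite im jk3 cur3 eqxx; split=> [j jk'|i|].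
      * by case: eqP; [lia|move=> _; apply: I3].
      * rewrite ltnS leq_eqVlt => /orP[/eqP->//|/I3' le].
        exact: le_trans le (ltW lt).
      * by exists m.
    move/(nltG ordM) => le; wp_run; split=> // i.
    by rewrite ltnS leq_eqVlt => /orP[/eqP->//|/I3'].
  + rewrite (proj1 d1) => st3 k3 [I3 I3' I3''] j.
    rewrite ltnS leq_eqVlt => /orP[/eqP->|/I3 //].
    by split.
- rewrite (proj2 d) => st1 k1 I1 k2 j /I1[le [i i_s e]].
  split=> [i' /le|]; first by rewrite (cur_keeps _ _ _ k2).
  by exists i => //; rewrite (cur_keeps _ _ _ k2).
Qed.

Definition search_lower_right : cmd :=
  (FOR ri <n rs DO
    IF lower_row ri THEN
      FOR rj <n rn DO
        IF right_col rj &b ent ri rj =g colmax rj THEN ru <-n ri ;; rv <-n rj FI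
      OD
    FI
  OD)%prog.

Lemma search_lower_right_wp st : dims st -> nval st ru = s ->
  wp search_lower_right (fun st' =>
    (nval st' ru < s /\ nval st' rv < n) \/
    (nval st' ru = s /\ forall i j, i < s -> nmem st star i = n -> ~~ right_max st i j)) st.
Proof.
move=> d us.
pose none i m := nmem st star i = n -> forall j, j < m -> ~~ right_max st i j.
pose J (P : Prop) st1 := (nval st1 ru < s /\ nval st1 rv < n) \/ nval st1 ru = s /\ P.
apply: (wp_for (Inv := fun k => J (forall i, i < k -> none i n))) => //.
- by right.
- rewrite (proj1 d) => k st1 ks ik k1 I1.
  have [s1 n1] := dims_keeps (c := search_lower_right) isT k1 d.
  wp_run; apply: wp_cond => /=; rewrite ik n1 (keepNA k1) // => lo; last first.
    wp_run; case: I1 => [|[? I1]]; [by left|right; split=> //= i].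
    rewrite ltnS leq_eqVlt => /orP[/eqP->|/I1 //].
    by move=> E; rewrite E eqxx in lo.
  apply: (wp_for (Inv := fun m => J ((forall i, i < k -> none i n) /\ none k m))) => //.
  + by case: I1 => [|[? ?]]; [left|right; split].
  + rewrite n1 => m st2 mn jm k2 I2.
    have ik2 : nval st2 ri = k by rewrite (keepN k2).
    wp_run; apply: wp_cond => /=; rewrite ik2 jm.
      by move=> _; wp_run; left; rewrite ik2 jm.
    rewrite (keepN k2) // s1 !(keepNA k2) // (keepI k2) !(keepGA k2) //.
    rewrite !(keepNA k1) // (keepI k1) !(keepGA k1) // => nr; wp_run.
    case: I2 => [|[? [I2 I2']]]; [by left|right; split=> //=; split=> //].
    move=> E j; rewrite ltnS leq_eqVlt => /orP[/eqP->|/I2' ->//].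
    by rewrite /right_max mn.
  + rewrite n1 => st2 k2 [|[? [I2 I2']]]; [by left|right; split=> //= i].
    by rewrite ltnS leq_eqVlt => /orP[/eqP->|/I2].
- rewrite (proj1 d) => st1 k1 [|[? I1]]; [by left|right; split=> // i j i_s lo].
  by case: (ltnP j n) => [jn|nj]; [apply: I1|rewrite /right_max ltnNge nj].
Qed.

(** The 30 operations beyond [p], here and for the other substeps, are left to
    the tests by which the main loop selects a substep. *)
Lemma prog_b_runs r (f : bool) p st : base r st -> (f -> promising st) ->
  (if f then 3 else 10) * heavy + later r <= p + 30 ->
  runs prog_b p st phase.
Proof.
move=> B pr le; have [d er r_s m] := B.
have [q lq1 lq2] : exists2 q, q + bound s n prog_b <= p &
    (if f then 2 else 9) * heavy + later r <= q.
  exists ((if f then 2 else 9) * heavy + later r) => //.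
  move: le; rewrite /heavy /=; case: (f) => /=; nia.
apply: (@runs_counted _ s n _ _ q) => //; first by rewrite addnC.
rewrite /prog_b; apply: wp_seq; apply: wp_mono (compute_colmax_wp d) _ => st1 k1 cm.
have d1 := dims_keeps (c := compute_colmax) isT k1 d.
have B1 := base_keeps (c := compute_colmax) isT k1 B.
have pr1 := fun h => promising_keeps (c := compute_colmax) isT k1 (pr h).
wp_run; rewrite (proj1 d1); set st2 := set_nval _ _ _.
have B2 : base r st2 by case: B1 => ? ? ? []; split.
have pr2 : f -> promising st2.
  move=> /pr1; apply: (@promising_keeps (ru <-n rs)%prog) => //.
  by apply: exec_keeps; rewrite /st2 -(proj1 d1); constructor.
apply: wp_mono (search_lower_right_wp (st := st2) d1 erefl) _ => st3 k3 S3.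
have B3 := base_keeps (c := search_lower_right) isT k3 B2; have [d3 er3 _ m3] := B3.
have pr3 := fun h => promising_keeps (c := search_lower_right) isT k3 (pr2 h).
apply: wp_cond => /=; rewrite (proj1 d3) => lt.
  case: S3 => [[us vn]|[]]; last by lia.
  wp_run; apply: (@next_stage_wp r) => //.
    by apply: (matched_put (u := nval st3 ru) (v := nval st3 rv) m3); rewrite //=; lia.
  by apply: leq_trans lq2; rewrite leq_addl.
case: S3 => [[]|[_ S3]]; first by lia.
apply: wp_keeps; wp_run => k4.
apply: (@At_c _ _ r f) => //; [exact: base_keeps k4 B3| |].
- split=> [j /cm[le1 [i i_s e]]|i j i_s]; rewrite /= ?(keepNA k3) //=; last first.
    move=> lo; have := S3 i j i_s lo; rewrite /right_max.
    by rewrite -(cur_keeps i j (st:=st2) (st':=st3) (c:=search_lower_right)) //= (keepNA k3) // (keepGA k3).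
  split.
    move=> l /le1; rewrite /= (keepGA k3) //= /cur /= (keepI k3) !(keepGA k3) //.
  exists i => //; rewrite /= (keepGA k3) //= -e.
  by rewrite /cur /= (keepI k3) !(keepGA k3).
- by move=> h; apply: promising_keeps k4 (pr3 h).
Qed.

(** * Substep c *)

(** The invariant of the traversal that closes the first class, started in
    [st0] with the rows that are then in the queue. *)
Record first_grown st0 st : Prop := FirstGrown {
  grown_ranked : ranked st;
  grown_queue : forall h, h < nval st rtl ->
    nmem st queue h < s /\ nmem st rclass (nmem st queue h) = 1;
  grown_prefix : forall h, h < nval st0 rtl ->
    h < nval st rtl /\ nmem st queue h = nmem st0 queue h;
  grown_class : forall i, i < s -> nmem st rclass i = nmem st0 rclass i \/
    nmem st rclass i = 1 /\ exists2 h, h < nval st rtl & nmem st queue h = i;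
  grown_total : nval st rtl + outside 1 st <= s }.

(** The traversal is started from a queue that may be only a part of the first
    class: in e'' it is the single row [i_0].  The closure property then holds
    for the rows of that queue and for the rows that are added. *)
Lemma close_first_class_runs st p q :
  dims st -> ranked st -> nval st rhd = 0 ->
  (forall h, h < nval st rtl -> nmem st queue h < s /\ nmem st rclass (nmem st queue h) = 1) ->
  nval st rtl + outside 1 st <= s -> 200 * (s * n) + q <= p ->
  runs close_first_class p st (fun p' st' =>
    [/\ q <= p', ranked st',
        forall i, i < s -> nmem st' rclass i = nmem st rclass i \/ nmem st' rclass i = 1 &
        forall i k, i < s -> k < s ->
          (exists2 h, h < nval st rtl & nmem st queue h = i) \/ nmem st rclass i <> 1 ->
          nmem st' rclass i = 1 -> nmem st star i < n -> edge st i k ->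
          nmem st' rclass k = 1]).
Proof.
move=> d rkd hd0 qu tot lep.
pose body := if close_first_class is While _ c then c else Skip.
pose C := bound s n body + 3.
(* credit for the rows that may still be queued, plus those waiting in the queue *)
pose Inv p1 st1 := [/\ keeps close_first_class st st1, first_grown st st1,
  forall h k, h < nval st1 rhd -> k < s -> nmem st star (nmem st1 queue h) < n ->
    edge st (nmem st1 queue h) k -> nmem st1 rclass k = 1,
  nval st1 rhd <= nval st1 rtl &
  (nval st1 rtl + outside 1 st1 - nval st1 rhd) * C + q <= p1].
have I0 : Inv (p - 3) st.
  split; rewrite ?hd0 //.
    split=> //; by [move=> h lt; split|move=> i _; left].
  apply: (@leq_trans (s * C + q)); first by rewrite leq_add2r leq_mul2r subn0 tot orbT.
  by rewrite /C /=; nia.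
have -> : p = 3 + (p - 3) by nia.
apply: runs_mono (runs_while (b := (rhd <n rtl)%prog) (Inv := Inv) _ I0) _; last first.
  move=> p' st' _ [[k f cl _ le] /=]; rewrite -leqNgt => ge; split.
  - by apply: leq_trans le; rewrite leq_addl.
  - by case: f.
  - by move=> i i_s; case: (grown_class f i_s) => [|[]]; [left|right].
  - move=> i l i_s ls act ci up e.
    suff [h hlt hi] : exists2 h, h < nval st' rtl & nmem st' queue h = i.
      by apply: (cl h) => //; rewrite ?hi //; apply: leq_trans ge.
    case: act => [[h /(grown_prefix f)[hlt eq] hi]|ci0].
      by exists h => //; rewrite eq.
    by case: (grown_class f i_s) => [e'|[_ //]]; case: ci0; rewrite -e'.
move=> q1 st1 [k1 f1 cl1 _ le1] /= lt.
exists (q1 - 3).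
  have : 0 < nval st1 rtl - nval st1 rhd by rewrite subn_gt0.
  by move: le1; rewrite /C; nia.
have d1 : dims st1 by case: d; split; rewrite (keepN k1).
have [i_s ci] := grown_queue f1 lt.
set h0 := nval st1 rhd in lt *; set i := nmem st1 queue h0 in i_s ci.
pose tot1 := nval st1 rtl + outside 1 st1.
apply: (@runs_counted _ s n _ _ ((tot1 - h0.+1) * C + q)) => //.
  have : tot1 - h0 = (tot1 - h0.+1).+1 by rewrite /tot1; lia.
  by move: le1; rewrite /C /= => le1 E; rewrite -/tot1 E in le1; nia.
have cur1 a b : (input st1 a b + gmem st1 ell a)%R = cur st a b.
  by exact: cur_keeps k1.
have st_keep a : nmem st1 star a = nmem st star a by rewrite (keepNA k1).
have fin st' : keeps body st1 st' -> first_grown st st' -> nval st' rhd = h0.+1 ->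
    (forall k, nmem st1 rclass k = 1 -> nmem st' rclass k = 1) ->
    (forall h, h < nval st1 rtl -> nmem st' queue h = nmem st1 queue h) ->
    nval st1 rtl <= nval st' rtl -> nval st' rtl + outside 1 st' <= tot1 ->
    (nmem st star i < n -> forall k, k < s -> edge st i k -> nmem st' rclass k = 1) ->
    Inv ((tot1 - h0.+1) * C + q) st'.
  move=> k f hd' cl qs tl' tt new; split=> //.
  - by apply: keeps_trans k1 k => -[[]|[]|[]|[]].
  - rewrite hd' => h l; rewrite ltnS leq_eqVlt => /orP[/eqP->|hlt] ls.
      by rewrite qs // -/i => up e; apply: new.
    rewrite qs; last by apply: ltn_trans hlt lt.
    by move=> up e; apply: cl; apply: cl1 e.
  - by rewrite hd'; apply: leq_trans tl'.
  - by rewrite hd' leq_add2r leq_mul2r leq_sub2r ?orbT.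
apply: wp_keeps; wp_run; rewrite -/h0 -/i; set st2 := set_nval _ rhd _.
have f2 : first_grown st st2 by case: f1 => r0 ? ? ? ?; split=> //.
apply: wp_cond => /=; rewrite -/i (proj2 d1) => up; last first.
  by apply: wp_skip => k3; apply: fin => //= up'; case/negP: up; rewrite st_keep.
apply: (wp_for (Inv := fun m st3 =>
  [/\ first_grown st st3, forall k, nmem st1 rclass k = 1 -> nmem st3 rclass k = 1,
      forall h, h < nval st1 rtl -> nmem st3 queue h = nmem st1 queue h,
      nval st1 rtl <= nval st3 rtl /\ nval st3 rtl + outside 1 st3 <= tot1 &
      forall k, k < m -> edge st i k -> nmem st3 rclass k = 1])) => //=.
- split=> //; by case: f2; split.
- rewrite (proj1 d1) => m st3 ms mk k3 [f3 mono3 qs3 [tl3 tt3] e3].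
  have iE : nval st3 ri = i by rewrite (keepN k3).
  have cur3 a b : (input st3 a b + gmem st3 ell a)%R = cur st a b.
    by rewrite (keepI k3) (keepGA k3) //= cur1.
  have star3 a : nmem st3 star a = nmem st star a by rewrite (keepNA k3) //= st_keep.
  apply: wp_cond => /=; rewrite mk iE !cur3 !star3.
    case/andP=> cm em; wp_run; rewrite iE mk; set st4 := set_nval _ rk _.
    have [] := @ranked_add st3 st4 i m i_s ms (mono3 _ ci) cm _ _ _ _ _ (grown_ranked f3) => //.
      by rewrite star3 -st_keep.
    move=> r4 o4; have t4 : nval st4 rtl = (nval st3 rtl).+1 by [].
    have q4 h : nmem st4 queue h = if nval st3 rtl == h then m else nmem st3 queue h by [].
    have c4 l : nmem st4 rclass l = if m == l then 1 else nmem st3 rclass l by [].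
    split=> //=.
    + split=> //.
      * move=> h; rewrite t4 ltnS q4 c4; case: eqP => [_ _|hne le]; first by rewrite eqxx.
        have [] := grown_queue f3 (h := h); first by lia.
        by move=> ? ->; rewrite if_same.
      * move=> h /(grown_prefix f3)[lt3 e4]; rewrite t4 q4; split; first by lia.
        by case: eqP => // ?; lia.
      * move=> l ls; rewrite c4; case: eqP => [<-|_].
          by right; split=> //; exists (nval st3 rtl); rewrite ?t4 ?q4 ?eqxx.
        case: (grown_class f3 ls) => [->|[-> [h hlt hq]]]; [by left|right].
        split=> //; exists h; first by rewrite t4; lia.
        by rewrite q4; case: eqP => // ?; lia.
      * by rewrite t4; have := grown_total f3; lia.
    + by move=> l /mono3->; rewrite if_same.
    + by move=> h hlt; case: eqP => [?|_]; [lia|apply: qs3].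
    + split; first by lia.
      rewrite -[outside 1 _]/(outside 1 st4); lia.
    + move=> l; rewrite ltnS leq_eqVlt => /orP[/eqP->|lt4 el]; first by rewrite eqxx.
      by rewrite (e3 l) ?if_same.
  rewrite negb_and negbK => no; wp_run; split=> //.
    by case: f3; split.
  move=> l; rewrite ltnS leq_eqVlt => /orP[/eqP->|lt4 el]; last exact: e3.
  by rewrite /edge => ee; case/orP: no => [/eqP//|]; rewrite ee eqxx.
- rewrite (proj1 d1) => st3 k3 [f3 mono3 qs3 [tl3 tt3] e3] kb.
  by apply: fin => //; rewrite (keepN k3).
Qed.

(** The first [k] rows have been examined; the upper ones that have a right
    maximal element are in the queue and have no predecessor. *)
Record seeded st0 k st : Prop := Seeded {
  seeded_class : forall i, i < k -> nmem st rclass i = 2 \/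
    [/\ nmem st rclass i = 1, nmem st prev i = s, nmem st rmax i < n &
        exists2 h, h < nval st rtl & nmem st queue h = i];
  seeded_max : forall i j, i < k -> nmem st0 star i < n -> right_max st0 i j ->
    nmem st rclass i = 1;
  seeded_queue : forall h, h < nval st rtl ->
    nmem st queue h < k /\ nmem st rclass (nmem st queue h) = 1;
  seeded_total :
    nval st rtl + count (fun i => nmem st rclass i != 1) (iota 0 k) <= k }.

Lemma seeded_next st0 k st st' :
  seeded st0 k st ->
  (forall i, i < k -> [/\ nmem st' rclass i = nmem st rclass i,
     nmem st' prev i = nmem st prev i & nmem st' rmax i = nmem st rmax i]) ->
  (forall h, h < nval st rtl -> nmem st' queue h = nmem st queue h) ->
  [/\ nmem st' rclass k = 2, nval st' rtl = nval st rtl &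
      nmem st0 star k < n -> forall j, ~~ right_max st0 k j] \/
  [/\ nmem st' rclass k = 1, nmem st' prev k = s, nmem st' rmax k < n,
      nval st' rtl = (nval st rtl).+1 & nmem st' queue (nval st rtl) = k] ->
  seeded st0 k.+1 st'.
Proof.
case=> cl mx qu tot old oq new.
have tl : nval st rtl <= nval st' rtl by case: new => [[_ -> _]|[_ _ _ -> _]].
split.
- move=> i; rewrite ltnS leq_eqVlt => /orP[/eqP->|lt].
    case: new => [[-> _ _]|[-> -> ? t e]]; [by left|right; split=> //].
    by exists (nval st rtl); rewrite ?t.
  have [-> -> ->] := old i lt; case: (cl i lt) => [->|[-> -> ? [h hlt hq]]]; [by left|right].
  by split=> //; exists h; [apply: leq_trans tl|rewrite oq].
- move=> i j; rewrite ltnS leq_eqVlt => /orP[/eqP->|lt] up mj.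
    by case: new => [[_ _ /(_ up j)]|[]] //; rewrite mj.
  by have [-> _ _] := old i lt; apply: mx mj.
- have qold h : h < nval st rtl ->
      nmem st' queue h < k.+1 /\ nmem st' rclass (nmem st' queue h) = 1.
    move=> lt; have [qk q1] := qu h lt; rewrite oq //; split; first exact: ltnW.
    by have [-> _ _] := old _ qk.
  case: new => [[_ -> _]|[c1 _ _ -> q1]] h; first exact: qold.
  by rewrite ltnS leq_eqVlt => /orP[/eqP->|/qold //]; rewrite q1 c1.
- rewrite count_iotaS (_ : count _ _ = count (fun i => nmem st rclass i != 1) (iota 0 k)).
    by case: new => [[-> -> _]|[-> _ _ -> _]] /=; lia.
  apply: eq_in_count => i; rewrite mem_iota /= => lt.
  by have [-> _ _] := old i lt.
Qed.

Definition seed_first_class : cmd :=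
  (FOR ri <n rs DO
    rclass@ri <-n 2 ;;
    IF upper_row ri THEN
      FOR rj <n rn DO
        IF right_col rj &b ent ri rj =g colmax rj THEN
          rclass@ri <-n 1 ;; rmax@ri <-n rj
        FI
      OD ;;
      IF rclass ri =n 1 THEN
        prev@ri <-n rs ;; queue@rtl <-n ri ;; rtl <-n NSuc rtl
      FI
    FI
  OD)%prog.

Lemma seed_first_class_wp st : dims st -> nval st rtl = 0 ->
  wp seed_first_class (seeded st s) st.
Proof.
move=> d tl0; apply: (wp_for (Inv := seeded st)) => //.
- by split=> //=; rewrite tl0.
- rewrite (proj1 d) => k st1 ks ik k1 I1.
  have [s1 n1] := dims_keeps (c := seed_first_class) isT k1 d.
  wp_run; rewrite ik; set st2 := set_nmem _ _ _ _.
  have star1 i : nmem st1 star i = nmem st star i by rewrite (keepNA k1).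
  apply: wp_cond => /=; rewrite ik n1 star1 => up; last first.
    wp_run; apply: seeded_next I1 _ _ _ => //= [i lt|].
      by split=> //; case: eqP => // ?; lia.
    by left; rewrite eqxx; split=> // up'; rewrite up' in up.
  apply: wp_seq; apply: (wp_for (Inv := fun m st3 =>
    [/\ forall l, l != k -> nmem st3 rclass l = nmem st1 rclass l /\
                            nmem st3 rmax l = nmem st1 rmax l,
        nmem st3 rclass k = 2 \/ nmem st3 rclass k = 1 /\ nmem st3 rmax k < n &
        forall j, j < m -> right_max st k j -> nmem st3 rclass k = 1])) => //=.
  + split=> //=; last by rewrite eqxx; left.
    by move=> l lk; rewrite eq_sym (negbTE lk).
  + rewrite n1 => m st3 mn jm k3 [old3 c3 mx3].
    have ik3 : nval st3 ri = k by rewrite (keepN k3).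
    apply: wp_cond => /=; rewrite ik3 jm.
      move=> _; wp_run; rewrite ik3 jm eqxx; split=> //; last by right.
      by move=> l lk; rewrite eq_sym (negbTE lk); apply: old3.
    rewrite (keepN k3) //= s1 (keepNA k3) //= (keepI k3) !(keepGA k3) //=.
    rewrite (keepNA k1) //= (keepI k1) !(keepGA k1) //= => nr; wp_run; split=> // j.
    rewrite ltnS leq_eqVlt => /orP[/eqP->|/mx3 //].
    by case/and3P=> _ e1 e2; case/negP: nr; apply/andP.
  + rewrite n1 => st3 k3 [old3 c3 mx3].
    have ik3 : nval st3 ri = k by rewrite (keepN k3).
    have tl3 : nval st3 rtl = nval st1 rtl by rewrite (keepN k3).
    apply: wp_cond => /=; rewrite ik3 => /eqP c1.
      wp_run; rewrite ik3 tl3; apply: seeded_next I1 _ _ _ => //= [i lt|h lt|].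
      * have ik' : i != k by rewrite ltn_eqF.
        have [-> ->] := old3 i ik'; split=> //; rewrite eq_sym (negbTE ik') (keepNA k3) //.
      * by case: eqP => [?|_]; [lia|rewrite (keepNA k3)].
      * right; rewrite !eqxx (keepN k3) //= s1; split=> //.
        by case: c3 => [|[]] //; rewrite c1.
    wp_run; apply: seeded_next I1 _ _ _ => //= [i lt|h lt|].
    * have ik' : i != k by rewrite ltn_eqF.
      by have [-> ->] := old3 i ik'; split=> //; rewrite (keepNA k3).
    * by rewrite (keepNA k3).
    * left; split=> //; first by case: c3 => [|[]].
      move=> _ j; apply/negP => mj; have jn : j < n by case/andP: mj.
      exact: c1 (mx3 j jn mj).
- by rewrite (proj1 d).
Qed.

(** If [promising], the row with a right maximal element is an upper row, since
    b has found nothing; so it is in the first class, which is closed, and the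
    path from this row puts a lower row there. *)
Lemma prog_c_runs r (f : bool) p st : base r st -> scanned st ->
  (f -> promising st) ->
  (if f then 2 else 9) * heavy + later r <= p + 30 ->
  runs prog_c p st phase.
Proof.
move=> B sc pr le; have [d er r_s m] := B.
set e := later r in le *.
pose q := (if f then 1 else 8) * heavy + e.
have lep : 399 * (s * n) + q <= p + 30.
  by move: le; rewrite /q /heavy; case: (f); lia.
have sn4 : 4 <= s * n by nia.
have lq : 100 * (s * n) + (200 * (s * n) + (q + 2)) <= p - 10 by lia.
rewrite /prog_c; apply: runs_keeps.
apply: runs_seq; apply: (@runs_counted _ s n _ _ (p - 2)) => //=; first by lia.
apply: wp_nset => /=; set st1 := set_nval _ _ _.
apply: runs_seq; apply: (@runs_counted _ s n _ _ (p - 4)) => //=; first by lia.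
apply: wp_nset => /=; set st2 := set_nval _ _ _.
apply: runs_seq; apply: (@runs_counted _ s n _ _ (200 * (s * n) + (q + 2))) => //.
  by rewrite /bound /=; nia.
apply: wp_mono (seed_first_class_wp (st := st2) d erefl) _ => st3 k3 [cl3 mx3 qu3 tot3].
have d3 := dims_keeps (c := seed_first_class) isT k3 (d : dims st2).
have star3 i : nmem st3 star i = nmem st star i by rewrite (keepNA k3).
have cur3 i j : cur st3 i j = cur st i j by rewrite (cur_keeps _ _ _ k3).
have rk3 : ranked st3.
  exists (fun=> 0) => i i_s c1; split.
    by apply: outside_le.
  by case: (cl3 i i_s) => [|[_ -> ? _]]; rewrite ?c1 ?ltnn.
apply: runs_seq; apply: runs_mono (close_first_class_runs (q := q + 2) d3 rk3 _ qu3 tot3 _) _ => //.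
  by rewrite (keepN k3).
move=> p4 st4 k4 [lq4 rk4 cl4 closed4].
have star4 i : nmem st4 star i = nmem st star i by rewrite (keepNA k4).
have cur4 i j : cur st4 i j = cur st i j by rewrite (cur_keeps _ _ _ k4).
apply: (@runs_counted _ s n _ _ q) => //=; first by rewrite addnC.
  by case: d3; split; rewrite (keepN k4).
apply: wp_nset => k; set st5 := set_nval _ _ _ in k *.
have B5 : base r st5 := base_keeps (c := prog_c) isT k B.
have rk5 : ranked st5 by case: rk4 => rk H; exists rk.
have cf : closed_first st4.
  move=> i l i_s ls ci up ed; apply: (closed4 i l) => //.
  + by case: (cl3 i i_s) => [->|[_ _ _]]; [right|left].
  + by rewrite star3 -star4.
  + by rewrite /edge !cur3 !star3; move: ed; rewrite /edge !cur4 !star4.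
have mx4 i j : i < s -> nmem st star i < n -> right_max st i j -> nmem st4 rclass i = 1.
  move=> i_s up mj; case: (cl4 i i_s) => [->|->] //.
  exact: mx3 mj.
case: sc => cm nolow.
have up_of i j : i < s -> right_max st i j -> nmem st star i < n.
  move=> i_s mj; rewrite ltn_neqAle (star_le m i_s) andbT.
  by apply/eqP => lo; move: mj; apply/negP/nolow.
case fT: f.
  have [i [j [i_s jn ow dr mxj]]] := pr fT.
  apply: (@At_d _ _ r) => //; last by rewrite /q fT mul1n.
  have mj : right_max st i j.
    have [ge [l ls el]] := cm j jn.
    rewrite /right_max jn ow eqxx; apply/eqP/le_anti.
    by rewrite ge //= -el mxj.
  have := @drains_closed predT st (fun i => nmem st4 rclass i = 1) i.
  case=> //; last by move=> l [ls lo c1]; exists l; split=> //=; rewrite star4.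
    move=> k' l ks ls ck _ _ up ed; apply: (cf k' l) => //; first by rewrite star4.
    by rewrite /edge !cur4 star4.
  exact: (mx4 i j i_s (up_of i j i_s mj) mj).
apply: (@At_d_or_e _ _ r) => //; last by rewrite /q fT.
split.
- split=> [j jn|i j i_s lo].
    have [ge [l ls el]] := cm j jn; split=> [a a_s|].
      by have := ge a a_s; rewrite /cur (keepI k) !(keepGA k).
    by exists l => //; move: el; rewrite /cur (keepI k) !(keepGA k).
  have := nolow i j i_s; rewrite /right_max /cur (keepI k) !(keepGA k) // !(keepNA k) //.
  by apply; rewrite -(keepNA k).
- by move=> i i_s; case: (cl4 i i_s) => /= ->; [case: (cl3 i i_s) => [|[]]|]; auto.
- move=> i j i_s mj; apply: (mx4 i j) => //.
    apply: (up_of i j) => //; move: mj.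
    by rewrite /right_max /cur (keepI k) !(keepGA k) // !(keepNA k).
  by move: mj; rewrite /right_max /cur (keepI k) !(keepGA k) // !(keepNA k).
- by move=> a b ? ?; apply: (cf a b).
Qed.

(** * Substep d *)

Definition search_lower_first : cmd :=
  (FOR ri <n rs DO
    IF lower_row ri &b rclass ri =n 1 THEN ru <-n ri FI
  OD)%prog.

Lemma search_lower_first_wp st : dims st -> nval st ru = s ->
  wp search_lower_first (fun st' =>
    [/\ nval st' ru < s, nmem st star (nval st' ru) = n &
        nmem st rclass (nval st' ru) = 1] \/
    nval st' ru = s /\ ~ lower_first st) st.
Proof.
move=> d us; apply: (wp_for (Inv := fun k st1 =>
  [/\ nval st1 ru < s, nmem st star (nval st1 ru) = n &
      nmem st rclass (nval st1 ru) = 1] \/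
  nval st1 ru = s /\
    forall i, i < k -> nmem st star i = n -> nmem st rclass i <> 1)) => //.
- by right.
- rewrite (proj1 d) => k st1 ks ik k1 I1.
  apply: wp_cond => /=; rewrite ik !(keepNA k1) // (keepN k1) // (proj2 d).
    by case/andP=> /eqP lo /eqP c1; wp_run; left; rewrite ik.
  move=> no; wp_run; case: I1 => [|[e I1]]; [by left|right; split=> //= i].
  rewrite ltnS leq_eqVlt => /orP[/eqP-> lo c1|]; last exact: I1.
  by case/negP: no; rewrite lo c1 !eqxx.
- rewrite (proj1 d) => st1 k1 [|[e I1]]; [by left|right; split=> //].
  by case=> i [i_s lo c1]; apply: (I1 i).
Qed.

Definition switch_path : cmd :=
  (WHILE prev ru <n rs DO
    put_star ru (star (prev ru)) ;;
    ru <-n prev ru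
  OD)%prog.

(** While the path from [u0] is followed backwards, [u0] is the only row that
    stops being lower, and the other rows that receive a star were upper. *)
Record switched st0 u0 st : Prop := Switched {
  sw_le : forall i, i < s -> nmem st star i <= n;
  sw_upper : forall i, nmem st0 star i < n -> nmem st star i < n;
  sw_lower : forall i, i != u0 -> nmem st0 star i = n -> nmem st star i = n;
  sw_owned : forall i, i < s -> nmem st star i < n ->
    nmem st owner (nmem st star i) != s;
  sw_right : forall j, nmem st0 owner j = s -> nmem st owner j = s;
  sw_cur : nval st ru = u0 \/ nmem st0 star (nval st ru) < n }.

(** The rank of the current row decreases in each round. *)
Lemma switch_path_runs r p q st : base r st -> ranked st ->
  nval st ru < s -> nmem st rclass (nval st ru) = 1 -> 40 * s + 10 + q <= p ->
  runs switch_path p st (fun p' st' => [/\ q <= p', switched st (nval st ru) st',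
    nval st' ru < s & nmem st' rmax (nval st' ru) < n]).
Proof.
move=> [[ds dn] _ _ m] [rk H] us uc lep.
pose Inv p1 st1 := [/\ keeps switch_path st st1, switched st (nval st ru) st1,
  nval st1 ru < s, nmem st rclass (nval st1 ru) = 1 &
  rk (nval st1 ru) * 40 + q <= p1].
have I0 : Inv (p - 4) st.
  split=> //; last by case: (H _ us uc) => ? _; lia.
  by case: m => sl so _ _; split=> //; left.
have -> : p = 4 + (p - 4) by lia.
apply: runs_mono (runs_while (b := (prev ru <n rs)%prog) (Inv := Inv) _ I0) _; last first.
  move=> p' st' _ [[k sw us' c1 le] /=].
  rewrite (keepNA k) // (keepN k (x := rs)) // ds => /negbTE ge; split=> //.
    by apply: leq_trans le; rewrite leq_addl.
  by have [_] := H _ us' c1; rewrite ge (keepNA k).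
move=> q1 st1 [k1 sw1 us1 c1 le1] /=; rewrite (keepNA k1) // (keepN k1 (x := rs)) // ds => lt.
have [_] := H _ us1 c1; rewrite lt => /and3P[/eqP cw sw rw].
set u := nval st1 ru in us1 c1 le1 lt cw sw rw *.
set w := nmem st prev u in lt cw sw rw *.
exists (q1 - 4); first by lia.
apply: (@runs_counted _ s n _ _ (rk w * 40 + q)) => //=; first by lia.
  by split; rewrite (keepN k1).
have wE : nmem st1 prev u = w by rewrite (keepNA k1).
(* as w <> u, the star of w survives the first store, and the second one reads it *)
have wu : (u == w) = false by apply/negbTE; rewrite eq_sym; apply: contraTneq rw => ->; rewrite ltnn.
apply: wp_keeps; wp_run; rewrite -/u wE wu => kb.
split=> //=.
- by apply: keeps_trans k1 kb => -[[]|[]|[]|[]].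
- case: sw1 => sl up lo ow ri cu.
  have vn : nmem st1 star w < n by apply: up.
  split=> /= [i i_s|i ui|i iu il|i i_s|j oj|].
  + by case: eqP => // _; [apply: ltnW|apply: sl].
  + by case: eqP => // _; apply: up.
  + case: eqP => [ui|_]; last exact: lo.
    by case: cu => [e|]; [case/eqP: iu; rewrite -ui|rewrite -/u ui il ltnn].
  + case: (u =P i) => [_ _|_ ui]; first by rewrite eqxx ltn_eqF.
    by case: (nmem st1 star w =P _) => _; [rewrite ltn_eqF|apply: ow].
  + case: eqP => [ej|_]; last exact: ri.
    by have := ow w lt vn; rewrite ej ri ?eqxx.
  + by right.
Qed.

(** Either a lower first class row is known to exist, or e' can be paid. *)
Lemma prog_d_runs r p st : base r st -> ranked st ->
  lower_first st /\ heavy + later r <= p + 30 \/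
  explored st /\ 8 * heavy + later r <= p + 30 ->
  runs prog_d p st phase.
Proof.
move=> B rkd alt; have [d er r_s m] := B.
set e := later r in alt.
have sn4 : 4 <= s * n by nia.
have s_n : s <= s * n by nia.
have lep : 370 * (s * n) + e <= p by case: alt => -[_]; rewrite /heavy; lia.
rewrite /prog_d; apply: runs_seq; apply: (@runs_counted _ s n _ _ (p - 2)) => //=; first by lia.
apply: wp_nset => /=; rewrite (proj1 d); set st1 := set_nval _ _ _.
apply: runs_seq; apply: (@runs_counted _ s n _ _ (p - 100 * (s * n))) => //=; first by lia.
apply: wp_mono (search_lower_first_wp (st := st1) d erefl) _ => st2 k2 S2.
have B1 : base r st1 by case: m => *; split.
have B2 : base r st2 := base_keeps (c := search_lower_first) isT k2 B1.
have [d2 er2 _ m2] := B2.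
have rk2 : ranked st2 := ranked_keeps (c := search_lower_first) isT k2 rkd.
apply: (@runs_cond _ _ _ _ _ (p - 100 * (s * n) - 3)) => /=; first by lia.
  rewrite (proj1 d2) => /eqP us; case: S2 => [[]|[_ nol]]; first by rewrite us ltnn.
  case: alt => [[lf _]|[ex le]]; first by case: nol.
  apply: (@runs_counted _ s n _ _ (7 * heavy + e)) => //.
    by rewrite /= /heavy; move: le; rewrite /heavy; lia.
  apply: wp_keeps; wp_run => k3.
  apply: (@At_e1 _ _ r) => //.
  - exact: base_keeps k3 B2.
  - exact: (explored_keeps (c := search_lower_first) isT k2 ex).
  - case=> i [i_s]; rewrite /= !(keepNA k2) // => lo c1; apply: nol.
    by exists i.
rewrite (proj1 d2) => us.
have [us2 lo2 c2] : [/\ nval st2 ru < s, nmem st star (nval st2 ru) = n &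
    nmem st rclass (nval st2 ru) = 1] by case: S2 => [//|[/eqP]]; rewrite (negbTE us).
apply: runs_seq; apply: runs_mono (switch_path_runs (q := e + 100) B2 rk2 us2 _ _) _; [|lia|].
  by rewrite (keepNA k2).
move=> p3 st3 k3 [le3 sw us3 rm3].
have d3 : dims st3 by case: d2; split; rewrite (keepN k3).
apply: (@runs_counted _ s n _ _ e) => //=; first by lia.
wp_run; apply: (@next_stage_wp r) => //=.
  by rewrite (keepN k3).
apply: (matched_next m2 (u := nval st2 ru) (v := nmem st3 rmax (nval st3 ru))); case: sw => sl up lo ow ri cu.
- by move=> i i_s /=; case: eqP => _; [apply: ltnW|apply: sl].
- move=> i i_s /=; case: (nval st3 ru =P i) => [_|_] u3; first by rewrite eqxx ltn_eqF.
  by case: (nmem st3 rmax _ =P _) => _; [rewrite ltn_eqF|apply: ow].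
- move=> i i_s iu il /=; case: eqP => [ui|_]; last exact: lo.
  case: cu => [eu|]; last by rewrite ui il ltnn.
  by case/eqP: iu; rewrite -ui.
- move=> j jn jv oj /=; rewrite eq_sym (negbTE jv); exact: ri.
Qed.

(** * Substep e' *)

(** The invariant of the traversal that computes the third class.  The first
    class does not change: it is closed and contains no lower row, so that no
    path leads from it to a lower row. *)
Record reached_back st0 st : Prop := ReachedBack {
  back_first : forall i, i < s -> (nmem st rclass i = 1 <-> nmem st0 rclass i = 1);
  back_lower : forall i, i < s -> nmem st0 star i = n -> nmem st rclass i = 3;
  back_drains : forall i, i < s -> nmem st rclass i = 3 -> drains (third st) st0 i;
  back_queue : forall h, h < nval st rtl ->
    nmem st queue h < s /\ nmem st rclass (nmem st queue h) = 3;
  back_total : nval st rtl + outside 3 st <= s }.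

Lemma reached_back_add r st0 st st' i k :
  matched r st0 -> closed_first st0 ->
  reached_back st0 st -> i < s -> k < s -> nmem st rclass i <> 3 ->
  nmem st rclass k = 3 -> edge st0 i k ->
  (forall l, nmem st' rclass l = if i == l then 3 else nmem st rclass l) ->
  (forall h, nmem st' queue h = if nval st rtl == h then i else nmem st queue h) ->
  nval st' rtl = (nval st rtl).+1 -> reached_back st0 st'.
Proof.
move=> m cf [fi lo dr qu tot] i_s ks ci ck ed ec eq et.
have up : nmem st0 star i < n.
  rewrite ltn_neqAle (star_le m i_s) andbT; apply/eqP => /(lo i i_s) //.
have old l : third st l -> third st' l.
  by move=> /eqP cl; rewrite /= ec cl if_same.
have dr' l : l < s -> nmem st rclass l = 3 -> drains (third st') st0 l.
  by move=> ls cl; apply: drains_mono (dr l ls cl) => // a _; apply: old.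
split.
- move=> l ls; rewrite ec; case: eqP => [<-|_]; last exact: fi.
  split=> // c1; have := cf _ _ i_s ks c1 up ed.
  by move/(fi k ks); rewrite ck.
- by move=> l ls /(lo l ls) e; rewrite ec e if_same.
- move=> l ls; rewrite ec; case: eqP => [<- _|_]; last exact: dr'.
  apply: (@drains_edge _ _ i k) => //; first by rewrite ec eqxx.
  exact: dr'.
- move=> h; rewrite et ltnS eq ec; case: eqP => [_ _|hne hle]; first by rewrite eqxx.
  have [|? ->] := qu h; first by lia.
  by rewrite if_same.
- have O : (outside 3 st').+1 = outside 3 st.
    apply: (@count_drop _ _ i); rewrite ?ec ?eqxx //; first exact/eqP.
    by move=> l li; rewrite ec [i == l]eq_sym (negbTE li).
  by rewrite et; lia.
Qed.

Definition seed_third_class : cmd :=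
  (FOR ri <n rs DO
    IF lower_row ri THEN
      rclass@ri <-n 3 ;; queue@rtl <-n ri ;; rtl <-n NSuc rtl
    FI
  OD)%prog.

Lemma seed_third_class_wp st : dims st -> nval st rtl = 0 ->
  (forall i, i < s -> nmem st rclass i = 1 \/ nmem st rclass i = 2) ->
  ~ lower_first st ->
  wp seed_third_class (reached_back st) st.
Proof.
move=> d tl0 cl nol; apply: (wp_for (Inv := fun k st1 =>
  [/\ forall i, i < s ->
        nmem st1 rclass i = if (i < k) && (nmem st star i == n) then 3 else nmem st rclass i,
      forall h, h < nval st1 rtl ->
        nmem st1 queue h < s /\ nmem st1 rclass (nmem st1 queue h) = 3 &
      nval st1 rtl + outside 3 st1 <= s])) => //.
- split=> //=; first by rewrite tl0.
  by rewrite tl0; apply: outside_le.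
- rewrite (proj1 d) => k st1 ks ik k1 [c1 q1 t1].
  apply: wp_cond => /=; rewrite ik (keepNA k1) // (keepN k1) // (proj2 d) => lo.
    repeat wp_step; cbv beta; set st2 := set_nval _ rtl _.
    have c2 l : nmem st2 rclass l = if k == l then 3 else nmem st1 rclass l by rewrite /= ik.
    have q2 h : nmem st2 queue h = if nval st1 rtl == h then k else nmem st1 queue h by rewrite /= ik.
    have t2 : nval st2 rtl = (nval st1 rtl).+1 by [].
    split.
    + move=> i i_s; rewrite c2 c1 // ltnS [i <= k]leq_eqVlt [k == i]eq_sym.
      by case: (i =P k) => [->|//]; rewrite lo.
    + move=> h; rewrite t2 ltnS q2 c2; case: eqP => [_ _|hne hle]; first by rewrite eqxx.
      have [|? ->] := q1 h; first by lia.
      by rewrite if_same.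
    + rewrite t2 -[outside 3 _]/(outside 3 st2).
      suff : (outside 3 st2).+1 = outside 3 st1 by lia.
      apply: (@count_drop _ _ k); rewrite ?c2 ?eqxx //; last first.
        by move=> l lk; rewrite c2 [k == l]eq_sym (negbTE lk).
      by rewrite c1 // ltnn /=; case: (cl k ks) => ->.
  wp_run; split=> // i i_s; rewrite /= c1 // ltnS [i <= k]leq_eqVlt.
  by case: (i =P k) => [->|//]; rewrite (negbTE lo) !andbF.
- rewrite (proj1 d) => st1 k1 [c1 q1 t1].
  have {}c1 i : i < s -> nmem st1 rclass i = if nmem st star i == n then 3 else nmem st rclass i.
    by move=> i_s; rewrite c1 // i_s.
  split=> // [i i_s|i i_s lo|i i_s].
  + rewrite c1 //; case: eqP => // lo; split=> // ci.
    by case: nol; exists i.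
  + by rewrite c1 // lo eqxx.
  + rewrite c1 //; case: eqP => [lo _|_ ci]; last by case: (cl i i_s); rewrite ci.
    by apply: drains_lower; rewrite //= c1 // lo eqxx.
Qed.

Definition close_third_class : cmd :=
  (WHILE rhd <n rtl DO
    rk <-n queue rhd ;;
    rhd <-n NSuc rhd ;;
    FOR ri <n rs DO
      IF rclass ri <>n 3 THEN
        IF ent rk (star ri) =g starred ri THEN
          rclass@ri <-n 3 ;; queue@rtl <-n ri ;; rtl <-n NSuc rtl
        FI
      FI
    OD
  OD)%prog.

Lemma close_third_class_runs r st0 st p q :
  dims st -> matched r st0 -> closed_first st0 ->
  (forall i, nmem st star i = nmem st0 star i) ->
  (forall i j, cur st i j = cur st0 i j) ->
  nval st rhd = 0 -> reached_back st0 st -> 200 * (s * n) + q <= p ->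
  runs close_third_class p st (fun p' st' => q <= p' /\ reached_back st0 st').
Proof.
move=> d m cf es ec hd0 rb lep.
pose body := if close_third_class is While _ c then c else Skip.
pose C := bound s n body + 3.
pose Inv p1 st1 := [/\ keeps close_third_class st st1, reached_back st0 st1,
  nval st1 rhd <= nval st1 rtl &
  (nval st1 rtl + outside 3 st1 - nval st1 rhd) * C + q <= p1].
have I0 : Inv (p - 3) st.
  split; rewrite ?hd0 //.
  apply: (@leq_trans (s * C + q)).
    by rewrite leq_add2r leq_mul2r subn0 (back_total rb) orbT.
  by rewrite /C /=; nia.
have -> : p = 3 + (p - 3) by nia.
apply: runs_mono (runs_while (b := (rhd <n rtl)%prog) (Inv := Inv) _ I0) _; last first.
  move=> p' st' _ [[_ rb' _ le] _]; split=> //.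
  by apply: leq_trans le; rewrite leq_addl.
move=> q1 st1 [k1 rb1 _ le1] /= lt.
exists (q1 - 3).
  have : 0 < nval st1 rtl - nval st1 rhd by rewrite subn_gt0.
  by move: le1; rewrite /C; nia.
have d1 : dims st1 by case: d; split; rewrite (keepN k1).
have [k_s ck] := back_queue rb1 lt.
set h0 := nval st1 rhd in lt *; set k := nmem st1 queue h0 in k_s ck.
pose tot1 := nval st1 rtl + outside 3 st1.
apply: (@runs_counted _ s n _ _ ((tot1 - h0.+1) * C + q)) => //.
  have : tot1 - h0 = (tot1 - h0.+1).+1 by rewrite /tot1; lia.
  by move: le1; rewrite /C /= => le1 E; rewrite -/tot1 E in le1; nia.
apply: wp_keeps; wp_run; rewrite -/h0 -/k; set st2 := set_nval _ rhd _.
apply: (wp_for (Inv := fun m st3 =>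
  [/\ reached_back st0 st3, forall l, nmem st1 rclass l = 3 -> nmem st3 rclass l = 3 &
      nval st1 rtl <= nval st3 rtl /\ nval st3 rtl + outside 3 st3 <= tot1])) => //=.
- split=> //; by case: rb1; split.
- rewrite (proj1 d1) => l st3 ls lk k3 [rb3 mono3 [tl3 tt3]].
  have kE : nval st3 rk = k by rewrite (keepN k3).
  have cur3 a b : (input st3 a b + gmem st3 ell a)%R = cur st0 a b.
    rewrite (keepI k3) (keepGA k3) //= -ec; exact: cur_keeps k1.
  have star3 a : nmem st3 star a = nmem st0 star a by rewrite (keepNA k3) //= (keepNA k1).
  apply: wp_cond => /=; rewrite lk => c3; last first.
    by wp_run; split=> //; case: rb3; split.
  apply: wp_cond => /=; rewrite lk kE !cur3 !star3 => /eqP ed; last first.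
    by wp_run; split=> //; case: rb3; split.
  repeat wp_step; cbv beta; set st4 := set_nval _ rtl _.
  have c4 a : nmem st4 rclass a = if l == a then 3 else nmem st3 rclass a by rewrite /= lk.
  have O : (outside 3 st4).+1 = outside 3 st3.
    apply: (@count_drop _ _ l); rewrite ?c4 ?eqxx // => a al.
    by rewrite c4 [l == a]eq_sym (negbTE al).
  split.
  + apply: (reached_back_add (st := st3) m cf rb3 (i := l) (k := k)) => //.
    * by move/eqP: c3.
    * exact: mono3.
    * by move=> h; rewrite /= lk.
  + by move=> a /mono3 e; rewrite c4 e if_same.
  + have t4 : nval st4 rtl = (nval st3 rtl).+1 by [].
    by rewrite -[outside 3 _]/(outside 3 st4) t4; split; lia.
- move=> st3 k3 [rb3 mono3 [tl3 tt3]] kb.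
  have hd3 : nval st3 rhd = h0.+1 by rewrite (keepN k3).
  split=> //; rewrite ?hd3.
  + by apply: keeps_trans k1 kb => -[[]|[]|[]|[]].
  + exact: leq_trans tl3.
  + by rewrite leq_add2r leq_mul2r leq_sub2r ?orbT.
Qed.

(** The flag [rfl] tells whether [x] already holds a minimum: it stands for the
    infinite initial value that [M] does not have. *)
Lemma min_with_wp x e st (Q : state M -> Prop) :
  (forall st', keeps (min_with x e) st st' -> nval st' rfl <> 0 ->
     gval st' x = geval st e \/ nval st rfl <> 0 /\ gval st' x = gval st x ->
     (gval st' x <= geval st e)%R ->
     (nval st rfl <> 0 -> (gval st' x <= gval st x)%R) -> Q st') ->
  wp (min_with x e) Q st.
Proof.
have xx : greg_beq x x = true by case: x.
move=> H; apply: wp_keeps; rewrite /min_with.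
apply: wp_cond => /= [/eqP f0|/eqP f1].
  by wp_run => k; apply: H => //=; rewrite ?xx //; left.
apply: wp_cond => /= [lt|/(nltG ordM) le]; wp_run => k; apply: H => //=; rewrite ?xx //.
- by left.
- by move=> _; apply: ltW.
- by right.
Qed.

Definition compute_dist : cmd :=
  (FOR ri <n rs DO
    IF rclass ri <>n 3 THEN
      rfl <-n 0 ;;
      FOR rk <n rs DO
        IF rclass rk =n 3 THEN
          min_with gx (starred ri -g ent rk (star ri))
        FI
      OD ;;
      dist@ri <-g gx
    FI
  OD)%prog.

Definition dist_reached st i v : Prop := exists k,
  [/\ k < s, nmem st rclass k = 3 &
      v = (cur st i (nmem st star i) - cur st k (nmem st star i))%R].

Lemma compute_dist_wp st l : dims st -> l < s -> nmem st rclass l = 3 ->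
  wp compute_dist (fun st' => forall i, i < s -> nmem st rclass i <> 3 ->
    dist_reached st i (gmem st' dist i)) st.
Proof.
move=> d ls cl.
apply: (wp_for (Inv := fun k st1 => forall i, i < k -> nmem st rclass i <> 3 ->
    dist_reached st i (gmem st1 dist i))) => //; last first.
  by rewrite (proj1 d) => st1 _ H i; apply: H.
rewrite (proj1 d) => k st1 ks ik k1 I1.
have [s1 n1] := dims_keeps (c := compute_dist) isT k1 d.
apply: wp_cond => /=; rewrite ik (keepNA k1) // => ck; last first.
  wp_run => i; rewrite ltnS leq_eqVlt => /orP[/eqP->|]; last exact: I1.
  by move/eqP=> c3; rewrite c3 in ck.
wp_run; apply: (wp_for (Inv := fun m st3 =>
  nval st3 rfl = 0 /\ (forall a, a < m -> nmem st rclass a <> 3) \/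
  nval st3 rfl <> 0 /\ dist_reached st k (gval st3 gx))) => //=.
- by left.
- rewrite s1 => m st3 ms mk k3 I3.
  have cls3 a : nmem st3 rclass a = nmem st rclass a by rewrite (keepNA k3) // (keepNA k1).
  apply: wp_cond => /=; rewrite mk cls3 => cm; last first.
    wp_run; case: I3 => [[f0 I3]|I3]; [left; split=> // a|by right].
    rewrite ltnS leq_eqVlt => /orP[/eqP->|]; last exact: I3.
    exact/eqP.
  apply: min_with_wp => st4 k4 f4 g4 _ _; right; split=> //=.
  case: g4 => [->|[f3 ->]] /=; last by case: I3 => [[]|[]].
  exists m; split=> //; first exact/eqP.
  rewrite mk (keepN k3) //= ik /cur !(keepNA k3) //= !(keepI k3) !(keepGA k3) //=.
  by rewrite !(keepNA k1) //= !(keepI k1) !(keepGA k1).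
- rewrite s1 => st3 k3 [[_ I3]|[_ I3]]; first by case: (I3 l ls).
  wp_run => i; rewrite (keepN k3) //= ik => ik' ci.
  case: eqP => [<-|ki]; first exact: I3.
  by rewrite (keepGA k3) //=; apply: I1 => //; lia.
Qed.

Definition compute_mm : cmd :=
  (FOR rj <n rn DO
    IF right_col rj THEN
      rfl <-n 0 ;;
      FOR ri <n rs DO
        IF rclass ri =n 1 THEN
          IF rfl =n 0 THEN mm@rj <-g ent ri rj ;; rfl <-n 1
          ELSE IF mm rj <g ent ri rj THEN mm@rj <-g ent ri rj FI FI
        FI
      OD
    FI
  OD)%prog.

Lemma compute_mm_wp st : dims st ->
  wp compute_mm (fun st' => forall i j, i < s -> nmem st rclass i = 1 ->
    j < n -> nmem st owner j = s -> (cur st i j <= gmem st' mm j)%R) st.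
Proof.
move=> d.
pose above st1 j m := forall i, i < m -> nmem st rclass i = 1 ->
  (cur st i j <= gmem st1 mm j)%R.
apply: (wp_for (Inv := fun k st1 => forall j, j < k -> nmem st owner j = s -> above st1 j s)) => //;
  last by rewrite (proj2 d) => st1 _ H i j i_s c1 jn ow; apply: H.
rewrite (proj2 d) => k st1 kn jk k1 I1.
have [s1 n1] := dims_keeps (c := compute_mm) isT k1 d.
apply: wp_cond => /=; rewrite jk (keepNA k1) // s1 => ck; last first.
  wp_run => j; rewrite ltnS leq_eqVlt => /orP[/eqP-> ow|]; last exact: I1.
  by case/eqP: ck.
wp_run; apply: (wp_for (Inv := fun m st3 =>
  [/\ forall j, j < k -> nmem st owner j = s -> above st3 j s,
      above st3 k m & nval st3 rfl = 0 -> forall i, i < m -> nmem st rclass i <> 1])) => //=.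
- rewrite s1 => m st3 ms im k3 [I3 I3' I3''].
  have cls3 a : nmem st3 rclass a = nmem st rclass a by rewrite (keepNA k3) // (keepNA k1).
  have jk3 : nval st3 rj = k by rewrite (keepN k3).
  have cur3 a b : (input st3 a b + gmem st3 ell a)%R = cur st a b.
    by rewrite (keepI k3) (keepGA k3) //=; exact: cur_keeps k1.
  apply: wp_cond => /=; rewrite im cls3 => cm; last first.
    wp_run; split=> // [i|f0 i]; rewrite ltnS leq_eqVlt => /orP[/eqP->|].
    + by move=> c1; case/eqP: cm.
    + exact: I3'.
    + exact/eqP.
    + exact: I3''.
  apply: wp_cond => /= [/eqP f0|/eqP f1].
    wp_run; rewrite im jk3 cur3; split=> // [j jk'|i].
      by rewrite /above /=; case: eqP => [|_]; [lia|apply: I3].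
    rewrite ltnS leq_eqVlt /= eqxx => /orP[/eqP-> //|lt c1].
    by case: (I3'' f0 i lt).
  apply: wp_cond => /=; rewrite im jk3 cur3; last first.
    move/(nltG ordM) => le; wp_run; split=> // i.
    by rewrite ltnS leq_eqVlt => /orP[/eqP->|] //; apply: I3'.
  move=> lt; wp_run; rewrite im jk3 cur3; split=> // [j jk'|i].
    by rewrite /above /=; case: eqP => [|_]; [lia|apply: I3].
  rewrite ltnS leq_eqVlt /= eqxx => /orP[/eqP-> //|lt' c1].
  exact: le_trans (I3' i lt' c1) (ltW lt).
- rewrite s1 => st3 k3 [I3 I3' _] j.
  by rewrite ltnS leq_eqVlt => /orP[/eqP->|] //; apply: I3.
Qed.

Definition compute_gd0 : cmd :=
  (FOR ri <n rs DO
    IF rclass ri =n 3 THEN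
      FOR rj <n rn DO
        IF right_col rj THEN min_with gd0 (mm rj -g ent ri rj) FI
      OD
    FI
  OD)%prog.

(** The row [l] and the column [j0] witness that the minimum is taken over a
    nonempty set; without them [gd0] would keep an arbitrary initial value. *)
Lemma compute_gd0_wp st l j0 : dims st -> nval st rfl = 0 ->
  l < s -> nmem st rclass l = 3 -> j0 < n -> nmem st owner j0 = s ->
  wp compute_gd0 (fun st' =>
    (exists i j, [/\ i < s, nmem st rclass i = 3, j < n, nmem st owner j = s &
       gval st' gd0 = (gmem st mm j - cur st i j)%R]) /\
    forall i j, i < s -> nmem st rclass i = 3 -> j < n -> nmem st owner j = s ->
      (gval st' gd0 <= gmem st mm j - cur st i j)%R) st.
Proof.
move=> d f0 ls cl j0n oj0.
pose att st1 := exists i j, [/\ i < s, nmem st rclass i = 3, j < n, nmem st owner j = s &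
       gval st1 gd0 = (gmem st mm j - cur st i j)%R].
pose lb st1 i m := nmem st rclass i = 3 -> forall j, j < m -> nmem st owner j = s ->
  nval st1 rfl <> 0 /\ (gval st1 gd0 <= gmem st mm j - cur st i j)%R.
pose J (P : Prop) st1 := P /\ (nval st1 rfl <> 0 -> att st1).
apply: (wp_for (Inv := fun k st1 => J (forall i, i < k -> lb st1 i n) st1)) => //.
- rewrite (proj1 d) => k st1 ks ik k1 [lb1 at1].
  have [s1 n1] := dims_keeps (c := compute_gd0) isT k1 d.
  apply: wp_cond => /=; rewrite ik (keepNA k1) // => ck; last first.
    wp_run; split=> // i; rewrite ltnS leq_eqVlt => /orP[/eqP-> c3|]; last exact: lb1.
    by case/eqP: ck.
  apply: (wp_for (Inv := fun m st3 =>
    J ((forall i, i < k -> lb st3 i n) /\ lb st3 k m) st3)) => //=.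
  + rewrite n1 => m st3 mn jm k3 [[lb3 lb3'] at3].
    have ik3 : nval st3 ri = k by rewrite (keepN k3).
    have cur3 a b : (input st3 a b + gmem st3 ell a)%R = cur st a b.
      by rewrite (keepI k3) (keepGA k3) //=; exact: cur_keeps k1.
    apply: wp_cond => /=; rewrite jm (keepNA k3) //= (keepNA k1) //= (keepN k3) //= s1 => cm; last first.
      wp_run; split=> //; split=> // c3 j.
      rewrite ltnS leq_eqVlt => /orP[/eqP-> ow|]; last exact: lb3'.
      by case/eqP: cm.
    apply: min_with_wp => st4 k4 f4 g4 le4 le4'; move: g4 le4.
    rewrite /= jm ik3 cur3 (keepGA k3) //= (keepGA k1) // => g4 le4.
    split; last first.
      move=> _; case: g4 => [e|[f3 e]]; last by rewrite /att /= e; exact: at3.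
      by exists k, m; split=> //; exact/eqP.
    split=> [i lt c3 j jn ow|c3 j]; last rewrite ltnS leq_eqVlt => /orP[/eqP-> ow|lt ow].
    * have [f3 le3] := lb3 i lt c3 j jn ow; split=> //=.
      exact: le_trans (le4' f3) le3.
    * by split.
    * have [f3 le3] := lb3' c3 j lt ow; split=> //=.
      exact: le_trans (le4' f3) le3.
  + rewrite n1 => st3 k3 [[lb3 lb3'] at3]; split=> // i.
    by rewrite ltnS leq_eqVlt => /orP[/eqP->|] //; apply: lb3.
- rewrite (proj1 d) => st1 k1 [lb1 at1]; split.
    by apply: at1; have [] := lb1 l ls cl j0 j0n oj0.
  by move=> i j i_s c3 jn ow; have [] := lb1 i i_s c3 j jn ow.
Qed.

(** That [m_j] bounds the whole of a right column [j] follows from [explored]: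
    a row with the maximum of the column belongs to the first class. *)
Lemma prog_e1_runs r p st : base r st -> ranked st -> explored st ->
  ~ lower_first st -> 7 * heavy + later r <= p + 30 ->
  runs prog_e1 p st phase.
Proof.
move=> B rkd ex nol; set e := later r => lep.
have [d er r_s m] := B; have [[cm nolow] cl mx cf] := ex.
have sn4 : 4 <= s * n by nia.
have s_n : s <= s * n by nia.
have n_n : n <= s * n by nia.
have ss_n : s * s <= s * n by nia.
have {}lep : 6 * heavy + (580 * (s * n) + e) <= p by move: lep; rewrite /heavy; lia.
rewrite /prog_e1; apply: runs_keeps.
apply: runs_seq; rewrite /compute_third_class.
apply: runs_seq; apply: (@runs_counted _ s n _ _ (p - 2)) => //=; first by lia.
apply: wp_nset => /=; set st1 := set_nval _ _ _.
apply: runs_seq; apply: (@runs_counted _ s n _ _ (p - 4)) => //=; first by lia.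
apply: wp_nset => /=; set st2 := set_nval _ _ _.
apply: runs_seq; apply: (@runs_counted _ s n _ _ (p - 4 - 40 * (s * n))) => //; first by rewrite /=; lia.
apply: wp_mono (seed_third_class_wp (st := st2) d erefl cl nol) _ => st3 k3 rb3.
have d3 := dims_keeps (c := seed_third_class) isT k3 (d : dims st2).
have m2 : matched r st2 by case: m; split.
apply: runs_mono (close_third_class_runs (q := 6 * heavy + (300 * (s * n) + e)) d3 m2 cf _ _ _ rb3 _) _.
- by move=> i; rewrite (keepNA k3).
- by move=> i j; rewrite (cur_keeps _ _ _ k3).
- by rewrite (keepN k3).
- by lia.
move=> p4 st4 k4 [le4 [fi4 lo4 dr4 _ _]].
have d4 : dims st4 by case: d3; split; rewrite (keepN k4).
have star4 i : nmem st4 star i = nmem st star i by rewrite (keepNA k4) // (keepNA k3).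
have owner4 i : nmem st4 owner i = nmem st owner i by rewrite (keepNA k4) // (keepNA k3).
have cur4 i j : cur st4 i j = cur st i j.
  by rewrite (cur_keeps _ _ _ k4) // (cur_keeps _ _ _ k3).
have [l ls lol] := lower_exists m r_s; have cl4 := lo4 l ls lol.
have [j0 j0n oj0] : exists2 j, j < n & nmem st4 owner j = s.
  have [|j jn oj] := right_exists m; first by lia.
  by exists j; rewrite ?owner4.
apply: runs_keeps; apply: runs_seq.
apply: (@runs_counted _ s n _ _ (6 * heavy + (200 * (s * n) + e))) => //; first by rewrite /=; lia.
apply: wp_mono (compute_dist_wp d4 ls cl4) _ => st5 k5 dist5.
have d5 := dims_keeps (c := compute_dist) isT k5 d4.
apply: runs_keeps; apply: runs_seq.
apply: (@runs_counted _ s n _ _ (6 * heavy + (130 * (s * n) + e))) => //; first by rewrite /=; lia.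
apply: wp_mono (compute_mm_wp d5) _ => st6 k6 mm6.
have d6 := dims_keeps (c := compute_mm) isT k6 d5.
apply: runs_seq; apply: (@runs_counted _ s n _ _ (6 * heavy + (130 * (s * n) + e) - 2)) => //=; first by lia.
apply: wp_nset => /=; set st7 := set_nval _ _ _.
have cls7 i : nmem st7 rclass i = nmem st4 rclass i by rewrite /= (keepNA k6) // (keepNA k5).
have owner7 i : nmem st7 owner i = nmem st4 owner i by rewrite /= (keepNA k6) // (keepNA k5).
have cur7 i j : cur st7 i j = cur st4 i j.
  by rewrite -(cur_keeps i j (c := compute_dist) isT k5) -(cur_keeps i j (c := compute_mm) isT k6).
apply: runs_seq; apply: (@runs_counted _ s n _ _ (6 * heavy + e + 2)) => //; first by rewrite /=; lia.
have := @compute_gd0_wp st7 l j0 d6 erefl ls _ j0n _.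
rewrite cls7 owner7 => /(_ cl4 oj0) gd0_wp.
apply: wp_mono gd0_wp _ => st8 k8 [at8 lb8].
have d8 := dims_keeps (c := compute_gd0) isT k8 (d6 : dims st7).
apply: (@runs_counted _ s n _ _ (6 * heavy + e)) => //; first by rewrite /=; lia.
apply: wp_nset => /= k59 k49 k9; set st9 := set_nval _ _ _ in k59 k49 k9 *.
have cls9 i : nmem st9 rclass i = nmem st4 rclass i by rewrite (keepNA k49).
have star9 i : nmem st9 star i = nmem st star i by rewrite (keepNA k9).
have owner9 i : nmem st9 owner i = nmem st owner i by rewrite (keepNA k9).
have cur9 i j : cur st9 i j = cur st i j by rewrite (cur_keeps _ _ _ k9).
have mm9 j : gmem st9 mm j = gmem st7 mm j by rewrite /= (keepGA k8).
apply: (@At_e2 _ _ r) => //.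
- exact: base_keeps k9 B.
- apply: ranked_same rkd => i; try by rewrite (keepNA k9).
  by move=> i_s; rewrite cls9; apply: fi4.
- split.
  + by move=> i i_s; rewrite star9 cls9; apply: lo4.
  + move=> i i_s; rewrite cls9 => /(dr4 i i_s); apply: drains_mono.
    * by move=> a _; rewrite /= cls9.
    * exact: star9.
    * by move=> a b _ _ _ _; rewrite /edge !cur9 !star9.
  + move=> i i_s; rewrite cls9 => /(dist5 i i_s)[a [as_ ca ea]].
    exists a; rewrite cls9 !cur9 star9 -!cur4 -star4 -ea; split=> //.
    by rewrite (keepGA k59).
  + case: at8 => i [j [i_s ci jn oj ea]]; exists i, j.
    by rewrite cls9 owner9 cur9 mm9 -cls7 -owner4 -owner7 -cur4 -cur7; split.
  + move=> i j i_s; rewrite cls9 -cls7 owner9 -owner4 -owner7 cur9 -cur4 -cur7 mm9.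
    exact: lb8.
  + move=> i j i_s jn; rewrite owner9 cur9 => oj.
    have [ge [a as_ ea]] := cm j jn.
    have ca : nmem st rclass a = 1.
      by apply: (mx a j) => //; rewrite /right_max jn oj ea !eqxx.
    apply: le_trans (ge i i_s) _; rewrite -ea mm9 -cur4 -(cur_keeps a j (c := compute_dist) isT k5).
    apply: mm6 => //; first by rewrite (keepNA k5) //; apply/(fi4 a as_).
    by rewrite (keepNA k5) // owner4.
- have := outside_le 3 st9.
  by rewrite /heavy /light; nia.
Qed.

(** * Substep e'' *)

Definition choose_increase : cmd :=
  (FOR ri <n rs DO
    IF rclass ri <>n 3 THEN
      IF dist ri <g gd THEN gd <-g dist ri ;; ru <-n ri FI
    FI
  OD)%prog.

Lemma choose_increase_wp st : dims st -> gval st gd = gval st gd0 -> nval st ru = s ->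
  wp choose_increase (fun st' =>
    (nval st' ru = s /\ gval st' gd = gval st gd0 \/
     [/\ nval st' ru < s, nmem st rclass (nval st' ru) <> 3 &
         gval st' gd = gmem st dist (nval st' ru)]) /\
    (gval st' gd <= gval st gd0)%R) st.
Proof.
move=> d eg us; apply: (wp_for (Inv := fun k st' =>
    (nval st' ru = s /\ gval st' gd = gval st gd0 \/
     [/\ nval st' ru < s, nmem st rclass (nval st' ru) <> 3 &
         gval st' gd = gmem st dist (nval st' ru)]) /\
    (gval st' gd <= gval st gd0)%R)) => //.
- by rewrite /= eg; split; [left|].
- rewrite (proj1 d) => k st1 ks ik k1 I1.
  apply: wp_cond => /=; rewrite ik (keepNA k1) // => ck; last by wp_run.
  apply: wp_cond => /=; rewrite ik (keepGA k1) // => lt; wp_run => //.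
  case: I1 => _ le; rewrite ik (keepGA k1) //; split; last exact: le_trans (ltW lt) le.
  by right; split=> //; apply/eqP.
Qed.

Definition increase_third : cmd :=
  (FOR ri <n rs DO
    IF rclass ri =n 3 THEN ell@ri <-g ell ri +g gd FI
  OD)%prog.

Lemma increase_third_wp st : dims st ->
  wp increase_third (fun st' => forall i j, i < s -> cur st' i j =
    if nmem st rclass i == 3 then (cur st i j + gval st gd)%R else cur st i j) st.
Proof.
move=> d; apply: (wp_for (Inv := fun k st1 => forall i, gmem st1 ell i =
    if (i < k) && (nmem st rclass i == 3) then (gmem st ell i + gval st gd)%R
    else gmem st ell i)) => //.
- rewrite (proj1 d) => k st1 ks ik k1 I1.
  apply: wp_cond => /=; rewrite ik (keepNA k1) // => ck; wp_run => i.
    rewrite ik I1 ltnn /= (keepG k1) // ltnS [i <= k]leq_eqVlt [k == i]eq_sym.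
    by case: (i =P k) => [->|_] /=; [rewrite ck|rewrite I1].
  rewrite I1 ltnS [i <= k]leq_eqVlt.
  by case: (i =P k) => [->|//]; rewrite (negbTE ck) !andbF.
- rewrite (proj1 d) => st1 k1 I1 i j i_s.
  rewrite /cur (keepI k1) I1 i_s /=; case: eqP => // _.
  by rewrite addrA.
Qed.

Definition update_dist : cmd :=
  (FOR ri <n rs DO
    IF rclass ri <>n 3 THEN
      dist@ri <-g dist ri -g gd ;;
      gy <-g starred ri -g ent ru (star ri) ;;
      IF gy <g dist ri THEN dist@ri <-g gy FI
    FI
  OD)%prog.

Lemma update_dist_wp st : dims st ->
  wp update_dist (fun st' => forall i, i < s -> nmem st rclass i <> 3 ->
    gmem st' dist i = (gmem st dist i - gval st gd)%R \/
    gmem st' dist i = (cur st i (nmem st star i) - cur st (nval st ru) (nmem st star i))%R) st.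
Proof.
move=> d.
pose new st1 i := gmem st1 dist i = (gmem st dist i - gval st gd)%R \/
    gmem st1 dist i = (cur st i (nmem st star i) - cur st (nval st ru) (nmem st star i))%R.
apply: (wp_for (Inv := fun k st1 =>
  (forall i, i < k -> nmem st rclass i <> 3 -> new st1 i) /\
  forall i, k <= i -> gmem st1 dist i = gmem st dist i)) => //.
- rewrite (proj1 d) => k st1 ks ik k1 [I1 O1].
  have cur1 a b : (input st1 a b + gmem st1 ell a)%R = cur st a b.
    exact: cur_keeps k1.
  have star1 a : nmem st1 star a = nmem st star a by rewrite (keepNA k1).
  have [g1 u1] : gval st1 gd = gval st gd /\ nval st1 ru = nval st ru.
    by rewrite (keepG k1) ?(keepN k1).
  apply: wp_cond => /=; rewrite ik (keepNA k1) // => ck; last first.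
    wp_run; split=> [i|i ki]; last by apply: O1; apply: ltnW.
    by rewrite ltnS leq_eqVlt => /orP[/eqP->|]; [move/eqP=> c3; rewrite c3 in ck|exact: I1].
  wp_run; apply: wp_cond => /=; rewrite ik star1 !cur1 u1 g1 eqxx O1 // => _; wp_run.
    rewrite ik; split=> [i|i ki]; last first.
      by case: eqP => [|_]; [lia|apply: O1; lia].
    rewrite /new ltnS leq_eqVlt /= => /orP[/eqP-> _|lt ci]; first by rewrite eqxx; right.
    by case: eqP => [|_]; [lia|apply: I1].
  split=> [i|i ki]; last first.
    by case: eqP => [|_]; [lia|apply: O1; lia].
  rewrite /new ltnS leq_eqVlt /= => /orP[/eqP-> _|lt ci]; first by rewrite eqxx; left.
  by case: eqP => [|_]; [lia|apply: I1].
- by rewrite (proj1 d) => st1 k1 [I1 _].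
Qed.

Definition update_gd0 : cmd :=
  (FOR rj <n rn DO
    IF right_col rj THEN
      gy <-g mm rj -g ent ru rj ;;
      IF gy <g gd0 THEN gd0 <-g gy FI
    FI
  OD)%prog.

Lemma update_gd0_wp st : dims st ->
  wp update_gd0 (fun st' =>
    [/\ gval st' gd0 = gval st gd0 \/ exists j, [/\ j < n, nmem st owner j = s &
          gval st' gd0 = (gmem st mm j - cur st (nval st ru) j)%R],
        (gval st' gd0 <= gval st gd0)%R &
        forall j, j < n -> nmem st owner j = s ->
          (gval st' gd0 <= gmem st mm j - cur st (nval st ru) j)%R]) st.
Proof.
move=> d; apply: (wp_for (Inv := fun k st' =>
    [/\ gval st' gd0 = gval st gd0 \/ exists j, [/\ j < n, nmem st owner j = s &
          gval st' gd0 = (gmem st mm j - cur st (nval st ru) j)%R],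
        (gval st' gd0 <= gval st gd0)%R &
        forall j, j < k -> nmem st owner j = s ->
          (gval st' gd0 <= gmem st mm j - cur st (nval st ru) j)%R])) => //.
- by split=> //; left.
- rewrite (proj2 d) => k st1 kn jk k1 [I1 I2 I3].
  have cur1 a b : (input st1 a b + gmem st1 ell a)%R = cur st a b.
    exact: cur_keeps k1.
  have [u1 s1] : nval st1 ru = nval st ru /\ nval st1 rs = s.
    by rewrite !(keepN k1) //; case: d.
  apply: wp_cond => /=; rewrite jk (keepNA k1) // s1 => ck; last first.
    wp_run; split=> // j; rewrite ltnS leq_eqVlt => /orP[/eqP-> oj|]; last exact: I3.
    by case/eqP: ck.
  wp_run; apply: wp_cond => /=; rewrite jk (keepGA k1) // cur1 u1; last first.
    move/(nltG ordM) => le; wp_run; split=> // j.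
    by rewrite ltnS leq_eqVlt => /orP[/eqP->|] //; apply: I3.
  move=> lt; wp_run; split.
  + by right; exists k; split=> //; apply/eqP.
  + exact: le_trans (ltW lt) I2.
  + move=> j; rewrite ltnS leq_eqVlt => /orP[/eqP->|jk' oj] //.
    exact: le_trans (ltW lt) (I3 j jk' oj).
- by rewrite (proj2 d).
Qed.

Definition prog_e2_start : cmd :=
  (((gd <-g gd0 ;; ru <-n rs) ;; choose_increase) ;; increase_third)%prog.

(** The state after the third class rows have been increased, with [gd] the
    increase [d] and [ru] the row [i_0], or [s] if [d = d_0]. *)
Record increased st st1 : Prop := Increased {
  inc_keeps : keeps prog_e2_start st st1;
  inc_choice : nval st1 ru = s /\ gval st1 gd = gval st gd0 \/
    [/\ nval st1 ru < s, nmem st rclass (nval st1 ru) <> 3 &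
        gval st1 gd = gmem st dist (nval st1 ru)];
  inc_le : (gval st1 gd <= gval st gd0)%R;
  inc_cur : forall i j, i < s -> cur st1 i j =
    if nmem st rclass i == 3 then (cur st i j + gval st1 gd)%R else cur st i j }.

Lemma prog_e2_start_wp st : dims st -> wp prog_e2_start (increased st) st.
Proof.
move=> d; apply: wp_keeps; rewrite {1}/prog_e2_start; do 5!wp_step; rewrite /=.
set st1 := set_nval _ _ _.
apply: wp_mono (choose_increase_wp (st := st1) d erefl (proj1 d)) _ => st2 k2 [c2 le2].
have d2 := dims_keeps (c := choose_increase) isT k2 (d : dims st1).
apply: wp_mono (increase_third_wp d2) _ => st3 k3 cur3 k.
split; rewrite ?(keepN k3 (x := ru)) ?(keepG k3 (x := gd)) // => i j i_s.
have E : cur st2 i j = cur st i j := cur_keeps i j (c := choose_increase) isT k2.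
by rewrite cur3 // (keepNA k2) // E.
Qed.

Lemma increased_mm_ge st st1 i j : classified st -> increased st st1 ->
  i < s -> j < n -> nmem st owner j = s -> (cur st1 i j <= gmem st mm j)%R.
Proof.
move=> cl inc i_s jn oj; rewrite (inc_cur inc) //.
case: eqP => [c3|_]; last exact: mm_ge.
by apply: (leG_subRL ordM); apply: le_trans (inc_le inc) (gd0_le cl i_s c3 jn oj).
Qed.

Lemma increased_drains (P : pred nat) st st1 i : classified st -> increased st st1 ->
  (forall k, k < s -> nmem st rclass k = 3 -> P k) ->
  i < s -> nmem st rclass i = 3 -> drains P st1 i.
Proof.
move=> cl inc H i_s ci; have es k := keepNA (inc_keeps inc) (a := star) isT k.
apply: drains_mono (third_drains cl i_s ci) => // [k ks /eqP|k l ks ls /eqP ck /eqP cl' e].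
  exact: H.
by rewrite /edge es !(inc_cur inc) // ck cl' eqxx e.
Qed.

(** [d_i] is the distance from the starred element of row [i] to some third
    class entry, which the increase therefore makes equal to it. *)
Lemma increased_edge r st st1 : matched r st -> classified st -> increased st st1 ->
  let u := nval st1 ru in
  u < s -> nmem st rclass u <> 3 -> gval st1 gd = gmem st dist u ->
  nmem st star u < n /\ exists k, [/\ k < s, nmem st rclass k = 3 & edge st1 u k].
Proof.
move=> m cl inc u us cu eg; split.
  by rewrite ltn_neqAle (star_le m us) andbT; apply/eqP => /(lower_third cl us).
have [k [ks ck ek]] := dist_attained cl us cu; exists k; split=> //.
rewrite /edge (keepNA (inc_keeps inc)) // !(inc_cur inc) // ck eqxx (introF eqP cu).
by rewrite eg ek addrC subrK.
Qed.

Lemma increase_d0_runs r p st st1 : base r st -> classified st -> increased st st1 ->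
  nval st1 ru = s -> 3 * heavy + later r + 3 <= p ->
  runs (rpc <-n step_b)%prog p st1 phase.
Proof.
move=> B cl inc us lep; have k1 := inc_keeps inc.
have B1 := base_keeps (c := prog_e2_start) isT k1 B; have [d1 _ _ _] := B1.
have eg : gval st1 gd = gval st gd0 by case: (inc_choice inc) => [[]|[]] //; rewrite us ltnn.
apply: (@runs_counted _ s n _ _ (3 * heavy + later r)) => //=; first by lia.
apply: wp_keeps; apply: wp_nset => k2.
apply: (@At_b _ _ r true) => //; first exact: base_keeps k2 B1.
move=> _; apply: promising_keeps k2 _ => //.
have [i [j [i_s ci jn oj e0]]] := gd0_attained cl.
exists i, j; rewrite (keepNA k1) //; split=> //.
  by apply: (increased_drains cl inc).
move=> k ks; rewrite (inc_cur inc j i_s) // ci eqxx eg e0 addrC subrK.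
exact: increased_mm_ge cl inc ks jn oj.
Qed.

Definition reach_from_first : cmd :=
  (rhd <-n 0 ;; queue@0 <-n ru ;; rtl <-n 1 ;; close_first_class ;; rpc <-n step_d)%prog.

Lemma reach_from_first_runs r p st st1 : base r st -> ranked st -> classified st ->
  increased st st1 -> nval st1 ru < s -> nmem st rclass (nval st1 ru) = 1 ->
  heavy + later r + 300 * (s * n) <= p ->
  runs reach_from_first p st1 phase.
Proof.
move=> B rkd cl inc u_s c1 lep; have k1 := inc_keeps inc; have [_ _ _ m] := B.
have B1 := base_keeps (c := prog_e2_start) isT k1 B; have [d1 _ _ _] := B1.
have rk1 := ranked_keeps (c := prog_e2_start) isT k1 rkd.
have cls1 i : nmem st1 rclass i = nmem st rclass i by rewrite (keepNA k1).
have star1 i : nmem st1 star i = nmem st star i by rewrite (keepNA k1).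
have [cu3 eg] : nmem st rclass (nval st1 ru) <> 3 /\
    gval st1 gd = gmem st dist (nval st1 ru).
  by case: (inc_choice inc) u_s => [[->]|[]] //; rewrite ltnn.
have [up [k [ks ck ek]]] := increased_edge m cl inc u_s cu3 eg.
have sn4 : 4 <= s * n by nia.
apply: runs_keeps; rewrite {1}/reach_from_first.
apply: runs_seq; apply: (@runs_counted _ s n _ _ (p - 10)) => //=; first by lia.
apply: wp_nset.
apply: runs_seq; apply: (@runs_counted _ s n _ _ (p - 20)) => //=; first by lia.
apply: wp_nstore.
apply: runs_seq; apply: (@runs_counted _ s n _ _ (p - 30)) => //=; first by lia.
apply: wp_nset => /=; set v := nval st1 ru in u_s c1 cu3 eg up ek *.
set st2 := set_nval _ _ _.
have d2 : dims st2 by [].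
have rk2 : ranked st2 by case: rk1 => f H; exists f.
apply: runs_seq.
apply: runs_mono (close_first_class_runs (q := heavy + later r + 2) d2 rk2 erefl _ _ _) _.
- by case=> //= _; rewrite cls1 c1.
- by rewrite add1n; apply: outside_lt u_s _; rewrite /= cls1.
- by lia.
move=> p3 st3 k3 [le3 rk3 cl3 closed3].
apply: (@runs_counted _ s n _ _ (heavy + later r)) => //=; first by lia.
  by case: d2; split; rewrite (keepN k3).
apply: wp_nset => k4; set st4 := set_nval _ _ _ in k4 *.
apply: (@At_d _ _ r) => //; first exact: base_keeps k4 B1.
have ck3 : nmem st3 rclass k = 1.
  apply: (closed3 v k) => //; first by left; exists 0.
  + by case: (cl3 v u_s) => // ->; rewrite /= cls1.
  + by rewrite /= star1.
have [] := @drains_closed (third st) st1 (fun i => nmem st3 rclass i = 1) k _ ck3.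
- move=> a b as_ bs a1 /eqP a3 /eqP b3 au ab; apply: (closed3 a b) => //.
  by right; rewrite /= cls1 a3.
- by apply: (increased_drains cl inc) => // a _ ->.
by move=> a [as_ la a1]; exists a; split=> //; rewrite /= (keepNA k3).
Qed.

Definition promote_second : cmd :=
  (rclass@ru <-n 3 ;; update_dist ;; gd0 <-g gd0 -g gd ;; update_gd0)%prog.

(** The differences with the third class decrease by [d], except those with the
    row that has just been added, which was not increased. *)
Lemma promote_second_runs r p st st1 : nval st rpc = step_e2 ->
  base r st -> ranked st -> classified st -> increased st st1 ->
  nval st1 ru < s -> nmem st rclass (nval st1 ru) <> 1 ->
  4 * heavy + (outside 3 st).-1 * light + later r + 60 * (s + n) <= p ->
  runs promote_second p st1 phase.
Proof.
move=> pc B rkd cl inc u_s cu1 lep; have k1 := inc_keeps inc; have [_ _ _ m] := B.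
have B1 := base_keeps (c := prog_e2_start) isT k1 B; have [d1 _ _ _] := B1.
have rk1 := ranked_keeps (c := prog_e2_start) isT k1 rkd.
have cls1 i : nmem st1 rclass i = nmem st rclass i by rewrite (keepNA k1).
have star1 i : nmem st1 star i = nmem st star i by rewrite (keepNA k1).
have owner1 i : nmem st1 owner i = nmem st owner i by rewrite (keepNA k1).
have mm1 i : gmem st1 mm i = gmem st mm i by rewrite (keepGA k1).
have cur1 := inc_cur inc.
have [cu3 eg] : nmem st rclass (nval st1 ru) <> 3 /\
    gval st1 gd = gmem st dist (nval st1 ru).
  by case: (inc_choice inc) u_s => [[->]|[]] //; rewrite ltnn.
have [up [k [ks ck ek]]] := increased_edge m cl inc u_s cu3 eg.
set v := nval st1 ru in u_s cu1 cu3 eg up ek.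
set q := 4 * heavy + (outside 3 st).-1 * light + later r.
apply: runs_keeps; apply: (@runs_counted _ s n _ _ q) => //.
  by apply: leq_trans lep; rewrite addnC leq_add2l /=; lia.
rewrite {1}/promote_second.
apply: wp_seq; apply: wp_nstore; rewrite /= -/v; set st2 := set_nmem _ _ _ _.
have d2 : dims st2 by [].
have cur2 i j : cur st2 i j = cur st1 i j by [].
have cls2 i : nmem st2 rclass i = if v == i then 3 else nmem st rclass i by rewrite /= cls1.
apply: wp_keeps; apply: wp_seq; apply: wp_mono (update_dist_wp d2) _ => st3 k3 di3.
have d3 := dims_keeps (c := update_dist) isT k3 d2.
apply: wp_keeps; wp_step; wp_step; rewrite /=; set st4 := set_gval _ _ _.
have cur4 i j : cur st4 i j = cur st1 i j := cur_keeps i j (c := update_dist) isT k3.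
have mm4 j : gmem st4 mm j = gmem st mm j by rewrite /= (keepGA k3) //= mm1.
have owner4 j : nmem st4 owner j = nmem st owner j by rewrite /= (keepNA k3) //= owner1.
have v4 : nval st4 ru = v by rewrite /= (keepN k3).
have gd04 : gval st4 gd0 = (gval st gd0 - gval st1 gd)%R.
  rewrite /= (keepG k3 (x := gd0)) //= (keepG k3 (x := gd)) //=.
  by rewrite (keepG k1 (x := gd0)).
apply: wp_mono (update_gd0_wp (d3 : dims st4)) _ => st5 k5 [at5 le5 lb5] k35 k25 k15.
rewrite v4 gd04 in at5 le5 lb5.
have cls5 i : nmem st5 rclass i = if v == i then 3 else nmem st rclass i.
  by rewrite (keepNA k25) // cls2.
have star5 i : nmem st5 star i = nmem st star i by rewrite (keepNA k15) // star1.
have owner5 i : nmem st5 owner i = nmem st owner i by rewrite (keepNA k15) // owner1.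
have cur5 i j : cur st5 i j = cur st1 i j by rewrite (cur_keeps _ _ _ k15).
have mm5 i : gmem st5 mm i = gmem st mm i by rewrite (keepGA k15) // mm1.
have dist5 i : gmem st5 dist i = gmem st3 dist i by rewrite (keepGA k35).
have dist2 i : gmem st2 dist i = gmem st dist i by rewrite /= (keepGA k1).
have out5 : outside 3 st5 = (outside 3 st).-1.
  apply: succn_inj; rewrite (@count_drop (fun i => nmem st rclass i != 3) _ v) //.
  - by rewrite prednK // /outside -has_count; apply/hasP; exists v; [rewrite mem_iota|apply/eqP].
  - exact/eqP.
  - by rewrite cls5 eqxx.
  - by move=> i iv; rewrite cls5 [v == i]eq_sym (negbTE iv).
apply: (@At_e2 _ _ r) => //; last by rewrite out5.
- by rewrite (keepN k15) // (keepN k1).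
- exact: base_keeps k15 B1.
- apply: ranked_same rk1 => i; try by rewrite (keepNA k15).
  by move=> i_s; rewrite cls5 cls1; case: eqP => // <-.
- have third5 i : i < s -> nmem st rclass i = 3 -> drains (third st5) st5 i.
    move=> i_s ci.
    have D : drains (third st5) st1 i.
      by apply: (increased_drains cl inc) => // a _ e3; rewrite /= cls5 e3 if_same.
    apply: drains_mono D => // [a|a b _ _ _ _]; first by rewrite star5 star1.
    by rewrite /edge !cur5 !star5 !star1.
  split.
  + by move=> i i_s; rewrite star5 cls5 => /(lower_third cl i_s)->; rewrite if_same.
  + move=> i i_s; rewrite cls5; case: eqP => [<- _|_]; last exact: third5.
    apply: (@drains_edge _ _ v k); rewrite ?star5 //= ?cls5 ?eqxx //.
      by move: ek; rewrite /edge !cur5 star5 star1.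
    exact: third5.
  + move=> i i_s; rewrite cls5; case: eqP => // vi ci.
    rewrite dist5 star5 !cur5; case: (di3 i i_s); rewrite ?cls2 ?dist2.
    * by case: eqP.
    * (* row a has been increased by d, row i has not *)
      move=> ->; have [a [as_ ca ea]] := dist_attained cl i_s ci.
      exists a; rewrite cls5 ca if_same !cur5; split=> //.
      rewrite -[gval st2 gd]/(gval st1 gd).
      rewrite !cur1 // ca eqxx ea (introF eqP ci).
      by rewrite (opprD _ (gval st1 gd)) addrA.
    * move=> ->; exists v; rewrite cls5 eqxx; split=> //.
      by rewrite cur5 !cur2 /= star1.
  + case: at5 => [->|[j [jn oj ->]]].
      have [i [j [i_s ci jn oj e0]]] := gd0_attained cl.
      exists i, j; rewrite cls5 ci if_same owner5; split=> //.
      by rewrite mm5 cur5 cur1 // ci eqxx e0 (opprD _ (gval st1 gd)) addrA.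
    by exists v, j; rewrite cls5 eqxx owner5 -owner4 mm5 cur5 mm4 cur4; split.
  + move=> i j i_s; rewrite cls5 owner5 mm5 cur5 => c3 jn oj.
    case: eqP c3 => [<- _|_ c3].
      by have := lb5 j jn; rewrite owner4 mm4 cur4; apply.
    apply: le_trans le5 _; rewrite cur1 // c3 eqxx (opprD _ (gval st1 gd)) addrA.
    by apply: (leG_sub2r ordM); apply: (gd0_le cl).
  + by move=> i j i_s jn; rewrite owner5 mm5 cur5; apply: (increased_mm_ge cl inc).
Qed.

Lemma prog_e2_runs r p st : nval st rpc = step_e2 ->
  base r st -> ranked st -> classified st ->
  4 * heavy + outside 3 st * light + later r <= p + 30 ->
  runs prog_e2 p st phase.
Proof.
move=> pc B rkd cl; set e := later r; set o := outside 3 st => lep.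
have [d _ _ _] := B.
have sn4 : 4 <= s * n by nia.
have s_n : s <= s * n by nia.
have lep' : 3 * heavy + (500 * (s * n) + e) <= p.
  by move: lep; rewrite /heavy; move: (o * light); lia.
(* 100 * s pays for the choice of d and for the increase itself *)
rewrite /prog_e2; do 3!apply: runs_assoc; apply: runs_seq.
apply: (@runs_counted _ s n prog_e2_start _ (p - 100 * s)) => //.
  by rewrite /=; lia.
apply: wp_mono (prog_e2_start_wp d) _ => st1 k1 inc.
have [d1 _ _ _] := base_keeps (c := prog_e2_start) isT k1 B.
apply: (@runs_cond _ _ _ _ _ (p - 100 * s - 3)) => /=; first by lia.
  rewrite (proj1 d1) => /eqP us.
  by apply: increase_d0_runs B cl inc us _; rewrite -/e; lia.
rewrite (proj1 d1) => us.
have u_s : nval st1 ru < s by case: (inc_choice inc) => [[e']|[]] //; rewrite e' eqxx in us.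
apply: (@runs_cond _ _ _ _ _ (p - 100 * s - 10)) => /=; first by lia.
  rewrite (keepNA k1) // => /eqP c1.
  by apply: reach_from_first_runs B rkd cl inc u_s c1 _; rewrite -/e; lia.
rewrite (keepNA k1) // => /eqP c1.
apply: (promote_second_runs pc B rkd cl inc u_s c1).
have o_light : o * light = o.-1 * light + light.
  rewrite -mulSnr prednK // /o /outside -has_count; apply/hasP.
  exists (nval st1 ru); first by rewrite mem_iota.
  apply/eqP; case: (inc_choice inc) => [[e']|[]] //.
  by rewrite e' eqxx in us.
move: lep; rewrite o_light -/o -/e; move: (o.-1 * light) => x.
by rewrite /light; lia.
Qed.

(** * Step 1 *)

(** Of the loops of step 1, this one and the next set up the stars, and
    [search_second] provides the column of the second maximum; the frame
    property deals with the others. *)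
Definition clear_rows : cmd :=
  (FOR ri <n rs DO ell@ri <-g GZero ;; star@ri <-n rn OD)%prog.

Definition clear_columns : cmd := (FOR rj <n rn DO owner@rj <-n rs OD)%prog.

Definition search_second : cmd :=
  (FOR ri <n rs DO
    IF ri <>n rp THEN
      FOR rj <n rn DO
        IF rj <>n 0 &b ent ri rj =g colmax rj THEN ru <-n ri ;; rv <-n rj FI
      OD
    FI
  OD)%prog.

Lemma clear_rows_wp st : dims st ->
  wp clear_rows (fun st' => forall i, i < s -> nmem st' star i = n) st.
Proof.
move=> d; apply: (wp_for (Inv := fun k st1 => forall i, i < k -> nmem st1 star i = n)) => //;
  last by rewrite (proj1 d).
move=> k st1 ks ik k1 I1; wp_run => i; rewrite ik (keepN k1) // (proj2 d).
by rewrite ltnS leq_eqVlt => /orP[/eqP->|/I1->]; rewrite ?eqxx ?if_same.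
Qed.

Lemma clear_columns_wp st : dims st ->
  wp clear_columns (fun st' => forall j, j < n -> nmem st' owner j = s) st.
Proof.
move=> d; apply: (wp_for (Inv := fun k st1 => forall j, j < k -> nmem st1 owner j = s)) => //;
  last by rewrite (proj2 d).
move=> k st1 kn jk k1 I1; wp_run => j; rewrite jk (keepN k1) // (proj1 d).
by rewrite ltnS leq_eqVlt => /orP[/eqP->|/I1->]; rewrite ?eqxx ?if_same.
Qed.

Lemma search_second_wp st : dims st -> nval st ru = s ->
  wp search_second (fun st' => nval st' ru < s -> 0 < nval st' rv < n) st.
Proof.
move=> d us; pose J (k : nat) (st1 : state M) := nval st1 ru < s -> 0 < nval st1 rv < n.
apply: (wp_for (Inv := J)) => //; first by rewrite /J /= us ltnn.
move=> k st1 ks ik k1 I1; apply: wp_cond => /= _; last by wp_run.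
apply: (wp_for (Inv := J)) => //; rewrite (keepN k1) // (proj2 d) => m st2 mn jm k2 I2.
apply: wp_cond => /= c0; wp_run => // _.
by rewrite /J /= jm mn andbT lt0n; move: c0; rewrite jm => /andP[].
Qed.

(** The two stars are put in different columns, and the second one in an actual
    row; [matched_put] then applies twice. *)
Lemma prog_step1_runs p st : dims st ->
  s * (10 * heavy) + heavy <= p -> runs prog_step1 p st phase.
Proof.
move=> d lep; have sn4 : 4 <= s * n by nia.
have s_n : s <= s * n by nia.
have n_n : n <= s * n by nia.
apply: (@runs_counted _ s n _ _ (s * (10 * heavy))) => //.
  by apply: leq_trans lep; rewrite addnC leq_add2l /heavy /=; lia.
rewrite /prog_step1.
apply: wp_seq; apply: wp_mono (clear_rows_wp d) _ => st1 k1 star1.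
have d1 := dims_keeps (c := clear_rows) isT k1 d.
apply: wp_seq; apply: wp_mono (clear_columns_wp d1) _ => st2 k2 owner2.
have d2 := dims_keeps (c := clear_columns) isT k2 d1.
have {}star2 i : i < s -> nmem st2 star i = n by move=> i_s; rewrite (keepNA k2) // star1.
have m2 : matched 0 st2.
  split=> [i /star2->//|i /star2->||]; first by rewrite ltnn.
    rewrite (eq_in_count (a2 := predT)) ?count_predT ?size_iota // => i.
    by rewrite mem_iota /= => /star2->; rewrite eqxx.
  rewrite (eq_in_count (a2 := predT)) ?count_predT ?size_iota // => i.
  by rewrite mem_iota /= => /owner2->; rewrite eqxx.
apply: wp_seq; apply: (wp_mono (fun _ _ _ => I)) => st3 k3 _.
apply: wp_seq; apply: (wp_mono (fun _ _ _ => I)) => st4 k4 _.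
apply: wp_seq; apply: (wp_mono (fun _ _ _ => I)) => st5 k5 _.
have d5 : dims st5.
  by case: d2; split; rewrite (keepN k5) // (keepN k4) // (keepN k3).
do 3!wp_step; rewrite /= (proj1 d5); set st6 := set_nval _ _ _.
apply: wp_mono (search_second_wp (st := st6) d5 erefl) _ => st7 k7 found.
have d7 := dims_keeps (c := search_second) isT k7 (d5 : dims st6).
have star7 i : nmem st7 star i = nmem st2 star i.
  by rewrite (keepNA k7) //= (keepNA k5) // (keepNA k4) // (keepNA k3).
have owner7 i : nmem st7 owner i = nmem st2 owner i.
  by rewrite (keepNA k7) //= (keepNA k5) // (keepNA k4) // (keepNA k3).
have m7 : matched 0 st7.
  case: m2 => sl so ll rl; split=> [i /sl|i /so||]; rewrite ?star7 ?owner7 //.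
  - by under eq_count do rewrite star7.
  - by under eq_count do rewrite owner7.
have free7 i v : i < s -> v < n -> nmem st7 star i != v.
  by move=> i_s vn; rewrite star7 star2 // gtn_eqF.
suff done8 st8 : dims st8 -> matched 2 st8 ->
    wp (rr <-n 2 ;; IF rr =n rs THEN rpc <-n halt ELSE rpc <-n step_b FI)%prog
       (phase (s * (10 * heavy))) st8.
  apply: wp_seq; apply: wp_cond => /=; rewrite (proj1 d7) => us.
    have /andP[v0 vn] := found us.
    do 8!wp_step; apply: done8 => //=.
    have m8 : matched 1 (set_nmem (set_nmem st7 star (nval st7 rp) 0) owner 0 (nval st7 rp)).
      by apply: (matched_put (u := nval st7 rp) (v := 0) m7) => // [|_ i i_s]; [lia|apply: free7; lia].
    apply: (matched_put (u := nval st7 ru) (v := nval st7 rv) m8) => //=.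
    by rewrite leqNgt us.
  do 5!wp_step; rewrite /=.
  set st8 := set_nmem _ owner _ _.
  have m8 : matched 1 st8.
    by apply: (matched_put (u := nval st7 rp) (v := 1) m7) => // [|_ i i_s]; [lia|apply: free7; lia].
  apply: wp_cond => /= _; do 3!wp_step; apply: done8 => //=.
    by apply: (matched_put (u := 1) (v := 0) m8) => //; lia.
  by apply: (matched_put (u := 0) (v := 0) m8) => //; lia.
move=> d8 m8; wp_run; apply: wp_cond => /=; rewrite (proj1 d8) => rs2; wp_run.
  exact: At_halt.
have lt2 : 2 < s by rewrite ltn_neqAle rs2; lia.
apply: (@At_b _ _ 2 false) => //; last exact: later_lt.
by split=> //; case: m8; split.
Qed.

(** * The main loop *)

Definition jacobi_body : cmd :=
  (IF rpc =n step_b THEN prog_b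
    ELSE IF rpc =n step_c THEN prog_c
    ELSE IF rpc =n step_d THEN prog_d
    ELSE IF rpc =n step_e1 THEN prog_e1
    ELSE prog_e2 FI FI FI FI)%prog.

Lemma jacobi_body_runs p st : phase p st -> nval st rpc != halt ->
  exists2 q, 4 + q <= p & runs jacobi_body q st phase.
Proof.
move=> ph nh.
have sn4 : 4 <= s * n by nia.
have h30 : 30 <= heavy by rewrite /heavy; lia.
have test (l q q' : nat) c1 c2 : q + 3 = q' ->
    (if nval st rpc == l then runs c1 q st phase else runs c2 q st phase) ->
    runs (Cond (rpc =n l)%prog c1 c2) q' st phase.
  move=> <- H; apply: (@runs_cond _ _ _ _ _ q) => /=; first by lia.
    by move=> e; rewrite e in H.
  by move=> /negbTE e; rewrite e in H.
exists (p - 4).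
  case: ph nh => [->//|r f _ _ _ le|r f _ _ _ _ le|r _ _ _ _ le|r _ _ _ _ le|
    r _ _ _ _ _ le|r _ _ _ _ le] _; try (move: le; case: (f)); lia.
case: ph nh => [->//|r f pc B pr le|r f pc B sc pr le|r pc B rkd lf le|r pc B rkd ex le|
  r pc B rkd ex nol le|r pc B rkd cl le] _.
- apply: (test _ (p - 7)); first by move: le; case: (f); lia.
  by rewrite pc eqxx; apply: (prog_b_runs B pr); lia.
- apply: (test _ (p - 7)); first by move: le; case: (f); lia.
  rewrite pc; apply: (test _ (p - 10)); first by move: le; case: (f); lia.
  by rewrite pc eqxx; apply: (prog_c_runs B sc pr); lia.
- apply: (test _ (p - 7)); first by lia.
  rewrite pc; apply: (test _ (p - 10)); first by lia.
  rewrite pc; apply: (test _ (p - 13)); first by lia.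
  by rewrite pc eqxx; apply: (prog_d_runs B rkd); left; split=> //; lia.
- apply: (test _ (p - 7)); first by lia.
  rewrite pc; apply: (test _ (p - 10)); first by lia.
  rewrite pc; apply: (test _ (p - 13)); first by lia.
  by rewrite pc eqxx; apply: (prog_d_runs B rkd); right; split=> //; lia.
- apply: (test _ (p - 7)); first by lia.
  rewrite pc; apply: (test _ (p - 10)); first by lia.
  rewrite pc; apply: (test _ (p - 13)); first by lia.
  rewrite pc; apply: (test _ (p - 16)); first by lia.
  by rewrite pc eqxx; apply: (prog_e1_runs B rkd ex nol); lia.
- apply: (test _ (p - 7)); first by lia.
  rewrite pc; apply: (test _ (p - 10)); first by lia.
  rewrite pc; apply: (test _ (p - 13)); first by lia.
  rewrite pc; apply: (test _ (p - 16)); first by lia.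
  by rewrite pc; apply: (prog_e2_runs pc B rkd cl); lia.
Qed.

Lemma jacobi_halts st : dims st ->
  exists t st', exec jacobi st t st' /\ t <= (11 * 600) * (s ^ 2 * n) + 4.
Proof.
move=> d; pose p0 := s * (10 * heavy).
have [t1 [st1 [p1 [E1 le1 ph1]]]] := @prog_step1_runs (p0 + heavy) st d (leqnn _).
have H q st2 : phase q st2 -> beval st2 (rpc <>n halt)%prog ->
    exists2 q', bcost (rpc <>n halt)%prog + q' <= q & runs jacobi_body q' st2 phase.
  by move=> ph nh; apply: jacobi_body_runs.
have [t2 [st2 [p2 [E2 le2 _]]]] := runs_while H ph1.
exists (t1 + t2), st2; split; first exact: exec_Seq E1 E2.
have {}le2 : t2 <= 4 + p1 by apply: leq_trans le2; rewrite leq_addr.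
(* at most s stages of ten heavy substeps each, and one such budget for step 1 *)
have heavy_le : p0 + heavy <= 11 * 600 * (s ^ 2 * n).
  have -> : s ^ 2 * n = s * (s * n) by rewrite mulnA.
  have : s * n <= s * (s * n) by rewrite leq_pmull; lia.
  by rewrite /p0 /heavy; lia.
by lia.
Qed.

End Jacobi.

Theorem theorem47 :
  exists a b : nat,
    forall (M : porderZmodType) (s n : nat) (A : 'M[M]_(s, n)) (st : state M),
      totally_ordered_group M -> 2 <= s <= n -> loaded A st ->
      exists (t : nat) (st' : state M),
        exec jacobi st t st' /\ t <= a * (s ^ 2 * n) + b.
Proof.
exists (11 * 600), 4 => M s n A st ordM sn [rs_s rn_n _].
exact: (jacobi_halts ordM sn).
Qed.
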